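(* Let $n\ge 3$ and $k\ge s\ge 3$ be integers, and let $G$ be a $2$-connected graph on $n$ vertices containing an edge $e$ with $c_e(G)\le k$. If $N_s(G)=g_s(n,k)$, then $M(G,e)=X_{n,k}$ (up to isomorphism).
   Context: All graphs are finite and simple; equality of graphs means isomorphism. $N_s(G)$ denotes the number of $s$-cliques of $G$. For an edge $e$ of $G$, $c_e(G)$ is the maximum length of a cycle of $G$ containing $e$. Let $\beta=\lfloor (n-2)/(k-2)\rfloor$ and $q=n-2-\beta(k-2)$. Then $X_{n,k}=K_2\vee(\beta K_{k-2}+K_q)$, where $\vee$ denotes the join, $+$ the disjoint union and $\beta K_{k-2}$ the disjoint union of $\beta$ copies of $K_{k-2}$. $g_s(n,k)$ is the number of $s$-cliques of $X_{n,k}$; for $s\ge 3$, $g_s(n,k)=\beta\binom{k}{s}+\binom{q+2}{s}$. For a $2$-connected graph $G$ with an edge $uv$ such that $c_{uv}(G)\le k$, $M(G,uv)$ denotes an edge-maximal graph with respect to $G$ and $uv$: a graph on vertex set $V(G)$ containing $G$ as a spanning subgraph, with $c_{uv}(M(G,uv))\le k$, such that for every non-edge $f$ of $M(G,uv)$ we have $c_{uv}(M(G,uv)+f)>k$. *)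

(* Defs.v *)
From mathcomp Require Import all_boot.

Set Implicit Arguments.
Unset Strict Implicit.
Unset Printing Implicit Defensive.

(* The vertex set is the whole finite type T. *)
Record sgraph (T : finType) := SGraph {
  adj :> rel T;
  adj_sym : symmetric adj;
  adj_irrefl : irreflexive adj }.

Definition graph_iso (T1 T2 : finType) (G : sgraph T1) (H : sgraph T2) : Prop :=
  exists2 f : T1 -> T2, bijective f & forall x y, H (f x) (f y) = G x y.

Lemma complete_sym (T : finType) : symmetric [rel x y : T | x != y].
Proof. by move=> x y /=; rewrite eq_sym. Qed.

Lemma complete_irrefl (T : finType) : irreflexive [rel x y : T | x != y].
Proof. by move=> x /=; rewrite eqxx. Qed.

Definition complete (m : nat) : sgraph 'I_m :=
  SGraph (@complete_sym 'I_m) (@complete_irrefl 'I_m).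

Section Constructions.

Variables (T1 T2 : finType) (G : sgraph T1) (H : sgraph T2).

Definition sum_rel (b : bool) : rel (T1 + T2)%type := fun x y =>
  match x, y with
  | inl a, inl c => G a c
  | inr a, inr c => H a c
  | _, _ => b
  end.

Lemma sum_rel_sym b : symmetric (sum_rel b).
Proof. by case=> x [] y //=; rewrite adj_sym. Qed.

Lemma sum_rel_irrefl b : irreflexive (sum_rel b).
Proof. by case=> x /=; rewrite adj_irrefl. Qed.

Definition join : sgraph (T1 + T2)%type :=
  SGraph (sum_rel_sym true) (sum_rel_irrefl true).

Definition disjoint_union : sgraph (T1 + T2)%type :=
  SGraph (sum_rel_sym false) (sum_rel_irrefl false).

Variable m : nat.

Definition copies_rel : rel ('I_m * T1)%type :=
  fun x y => (x.1 == y.1) && G x.2 y.2.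

Lemma copies_rel_sym : symmetric copies_rel.
Proof. by move=> x y; rewrite /copies_rel eq_sym adj_sym. Qed.

Lemma copies_rel_irrefl : irreflexive copies_rel.
Proof. by move=> x; rewrite /copies_rel adj_irrefl andbF. Qed.

Definition copies : sgraph ('I_m * T1)%type :=
  SGraph copies_rel_sym copies_rel_irrefl.

End Constructions.

Section Graph.

Variables (T : finType) (G : sgraph T).

Definition del_rel (S : {set T}) : rel {x : T | x \notin S} :=
  fun x y => G (val x) (val y).

Lemma del_rel_sym S : symmetric (@del_rel S).
Proof. by move=> x y; apply: adj_sym. Qed.

Lemma del_rel_irrefl S : irreflexive (@del_rel S).
Proof. by move=> x; apply: adj_irrefl. Qed.

Definition del_vertices (S : {set T}) : sgraph {x : T | x \notin S} :=
  SGraph (@del_rel_sym S) (@del_rel_irrefl S).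

Definition add_rel (a b : T) : rel T := fun x y =>
  G x y || (a != b) && ((x == a) && (y == b) || (x == b) && (y == a)).

Lemma add_rel_sym a b : symmetric (add_rel a b).
Proof.
move=> x y; rewrite /add_rel adj_sym; congr (_ || (_ && _)).
by rewrite orbC [(x == b) && _]andbC [(x == a) && _]andbC.
Qed.

Lemma add_rel_irrefl a b : irreflexive (add_rel a b).
Proof.
move=> x; rewrite /add_rel adj_irrefl /=; apply/negP=> /andP[/negP ab].
by case/orP=> /andP[/eqP xa /eqP xb]; apply: ab; rewrite -xa -xb.
Qed.

Definition add_edge (a b : T) : sgraph T :=
  SGraph (add_rel_sym a b) (add_rel_irrefl a b).

Definition is_clique (S : {set T}) : bool :=
  [forall x in S, forall y in S, (x != y) ==> G x y].

Definition num_cliques (s : nat) : nat :=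
  #|[set S : {set T} | (#|S| == s) && is_clique S]|.

(* c lists the vertices of a cycle in cyclic order, and u, v are consecutive. *)
Definition cycle_through (u v : T) (c : seq T) : bool :=
  [&& 2 < size c, ucycleb G c, u \in c & (next c u == v) || (prev c u == v)].

(* The value is 0 if no cycle contains the edge uv. *)
Definition max_cycle_length (u v : T) : nat :=
  \max_(l < #|T|.+1 | [exists c : l.-tuple T, cycle_through u v c]) l.

End Graph.

Definition connected (T : finType) (G : sgraph T) : Prop :=
  forall x y : T, connect G x y.

Definition two_connected (T : finType) (G : sgraph T) : Prop :=
  2 < #|T| /\
  forall S : {set T}, #|S| < 2 -> connected (del_vertices G S).

(* M is a possible choice for M(G, uv); such an M need not be unique. *)
Definition edge_maximal (T : finType) (G : sgraph T) (u v : T) (k : nat)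
    (M : sgraph T) : Prop :=
  [/\ forall x y, G x y -> M x y,
      max_cycle_length M u v <= k
    & forall x y, x != y -> ~~ M x y ->
        k < max_cycle_length (add_edge M x y) u v].

Definition beta (n k : nat) : nat := (n - 2) %/ (k - 2).
Definition remainder (n k : nat) : nat := n - 2 - beta n k * (k - 2).

Definition X_graph (n k : nat) :
    sgraph ('I_2 + ('I_(beta n k) * 'I_(k - 2) + 'I_(remainder n k)))%type :=
  join (complete 2)
    (disjoint_union (copies (complete (k - 2)) (beta n k))
                    (complete (remainder n k))).

Definition g (s n k : nat) : nat := num_cliques (X_graph n k) s.

(* Main.v *)
Require Import Defs.
From mathcomp Require Import all_boot.
From mathcomp Require Import zify.

(**
Write N_s for the number of s-cliques and g_s for the value attained by X_{n,k}.
The function g_s satisfies g_s(n1) + g_s(n2) <= g_s(n1 + n2 - 2), so a graph can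
be split along a 2-cut. If V \ {u, v} is disconnected, or if {u, w} is a cut for
some neighbour w of u, induction applies to the two sides, each closed up by the
edge uv, resp. uw. Otherwise the Kelmans shift from a neighbour w to u (give to u
all neighbours of w, and leave to w the common ones) preserves 2-connectedness,
does not lower N_s and creates no longer u-v path; iterating it makes u and v
adjacent to every vertex. Then V \ {u, v} is a connected graph without paths on
more than k - 2 vertices, and Kopylov's argument (edge-maximality, degree cores
and Posa's crossing of two disjoint paths) gives
N_s <= C(k-a+2, s) + (n-k+a-2) C(a, s-1) with 3 <= a and 2a <= k + 1, which is
smaller than g_s(n, k) by convexity of the binomial coefficients.
Hence equality forces every component of M \ {u, v} to have at most k - 2
vertices; edge-maximality makes the components complete, and the strict form of
superadditivity leaves room for at most one component of smaller size.
*)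

Set Implicit Arguments.
Unset Strict Implicit.
Unset Printing Implicit Defensive.

(** * Binomial inequalities *)

Lemma bin_le s m n : m <= n -> 'C(m, s) <= 'C(n, s).
Proof. by move=> ?; apply: leq_bin2l. Qed.

Lemma bin_lt s m n : 0 < s -> m < n -> s <= n -> 'C(m, s) < 'C(n, s).
Proof.
case: s => // s _; case: n => // n ltmn lesn.
rewrite binS; have := bin_le s.+1 (ltmn : m <= n); have : 0 < 'C(n, s) by rewrite bin_gt0.
lia.
Qed.

Lemma bin_convex s a b d :
  b <= a -> 'C(a, s) + 'C(b + d, s) <= 'C(a + d, s) + 'C(b, s).
Proof.
case: s => [|s] leba; first by rewrite !bin0.
elim: d => [|d IHd]; first by rewrite !addn0.
rewrite !addnS !binS; have := bin_le s (_ : b + d <= a + d); lia.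
Qed.

Lemma bin_convex_strict s a b d :
    1 < s -> b < a -> 0 < d -> s <= a + d ->
  'C(a, s) + 'C(b + d, s) < 'C(a + d, s) + 'C(b, s).
Proof.
case: s => // s s_gt0 ltba; case: d => // d _ lesd.
rewrite !addnS !binS; have := bin_convex s.+1 d (ltnW ltba).
have := @bin_lt s (b + d) (a + d); lia.
Qed.

(* The line of slope 'C(a, s) through (a, 'C(a, s.+1)) lies below m |-> 'C(m, s.+1);
   both sides are moved so that no subtraction occurs. *)
Lemma bin_tangent s a m :
  'C(a, s.+1) + m * 'C(a, s) <= 'C(m, s.+1) + a * 'C(a, s).
Proof.
have [leam | ltma] := leqP a m.
  rewrite -(subnKC leam); elim: (m - a) => [|d IHd]; first by rewrite addn0.
  rewrite addnS binS; have := bin_le s (leq_addr d a); lia.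
have [d ->] : exists d, a = m + d by exists (a - m); rewrite subnKC // ltnW.
have: forall e, e <= d -> 'C(m + e, s.+1) <= 'C(m, s.+1) + e * 'C(m + d, s).
  elim=> [|e IHe] lee; first by rewrite addn0 mul0n addn0.
  rewrite addnS binS mulSn; have := @bin_le s (m + e) (m + d).
  by have := IHe (ltnW lee); lia.
by move/(_ d (leqnn d)); lia.
Qed.

Lemma bin_pairs_strict s a d : 1 < s -> s <= a.+1 -> 0 < d -> d <= a ->
  'C(a.+1, s.+1) + 'C(a - d, s.+1) + 2 * d * 'C(a, s)
    < 'C(a.+1 + d, s.+1) + 'C(a, s.+1).
Proof.
move=> s_gt1 lesa; case: d => // d _.
elim: d => [|d IHd] leda.
  case: a leda lesa => // b _ lesb; rewrite addn1 subn1 /= (binS b.+2) (binS b.+1) (binS b).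
  have := @bin_convex_strict s b.+1 b 1 s_gt1; rewrite !addn1; lia.
have {}IHd := IHd (ltnW leda).
have e : a - d.+1 = (a - d.+2).+1 by lia.
have e1 : a.+1 + d.+2 = (a + d.+2).+1 by lia.
have e2 : a.+1 + d.+1 = a + d.+2 by lia.
have := @bin_convex s a (a - d.+2) d.+2 (leq_subr _ _).
rewrite subnK // e1 (binS (a + _)); move: IHd; rewrite e e2 (binS (a - _)); lia.
Qed.

(* The number of s-cliques of X_{n,k}, valid for 2 < s. *)
Definition extremal (s k n : nat) : nat :=
  ((n - 2) %/ (k - 2)) * 'C(k, s) + 'C((n - 2) %% (k - 2) + 2, s).

Section Extremal.

Variables s k : nat.
Hypotheses (s_gt2 : 2 < s) (lesk : s <= k).

Let bin2s : 'C(2, s) = 0. Proof. by rewrite bin_small. Qed.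

Lemma extremal_small n : 2 <= n <= k -> extremal s k n = 'C(n, s).
Proof.
move=> /andP[n_ge2 lenk]; rewrite /extremal; have [ltnk | gek] := ltnP n k.
  by rewrite divn_small ?modn_small ?mul0n ?add0n ?subnK //; apply: ltn_sub2r => //; apply: leq_trans ltnk.
have -> : n = k by lia.
by rewrite divnn modnn add0n bin2s addn0 subn_gt0 (leq_trans s_gt2) // mul1n.
Qed.

Lemma extremal_step n : 2 <= n -> extremal s k (n + (k - 2)) = extremal s k n + 'C(k, s).
Proof.
move=> n_ge2; rewrite /extremal; have -> : n + (k - 2) - 2 = n - 2 + (k - 2) by lia.
rewrite modnDr divnDr ?dvdnn // divnn; have -> : 0 < k - 2 by lia.
lia.
Qed.

Lemma extremal_superadd_low n1 n2 : 2 <= n1 <= k -> 2 <= n2 <= k ->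
  extremal s k n1 + extremal s k n2 <= extremal s k (n1 + n2 - 2).
Proof.
move=> n1k n2k; rewrite (extremal_small n1k) (extremal_small n2k).
have [le_k | gt_k] := leqP (n1 + n2 - 2) k.
  rewrite extremal_small; last by lia.
  have := @bin_convex s n1 2 (n2 - 2); rewrite subnKC ?bin2s; last by lia.
  have -> : n1 + (n2 - 2) = n1 + n2 - 2 by lia.
  lia.
have -> : n1 + n2 - 2 = n1 + n2 - k + (k - 2) by lia.
rewrite extremal_step; last by lia.
rewrite extremal_small; last by lia.
have := @bin_convex s n1 (n1 + n2 - k) (k - n1).
have -> : n1 + n2 - k + (k - n1) = n2 by lia.
have -> : n1 + (k - n1) = k by lia.
lia.
Qed.

Lemma extremal_superadd_strict n1 n2 : 2 <= n1 < k -> 2 <= n2 < k ->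
  k <= n1 + n2 - 2 -> extremal s k n1 + extremal s k n2 < extremal s k (n1 + n2 - 2).
Proof.
move=> n1k n2k lek; rewrite (@extremal_small n1) ?(@extremal_small n2); try lia.
have -> : n1 + n2 - 2 = n1 + n2 - k + (k - 2) by lia.
rewrite extremal_step; last by lia.
rewrite extremal_small; last by lia.
have := @bin_convex_strict s n1 (n1 + n2 - k) (k - n1).
have -> : n1 + n2 - k + (k - n1) = n2 by lia.
have -> : n1 + (k - n1) = k by lia.
lia.
Qed.

Lemma extremal_superadd n1 n2 : 2 <= n1 -> 2 <= n2 ->
  extremal s k n1 + extremal s k n2 <= extremal s k (n1 + n2 - 2).
Proof.
have [m] := ubnP (n1 + n2); elim: m n1 n2 => // m IHm n1 n2 ltm n1_ge2 n2_ge2.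
have red i j : i + j <= n1 + n2 -> 2 <= i -> 2 <= j -> k < i ->
    extremal s k i + extremal s k j <= extremal s k (i + j - 2).
  move=> leij i_ge2 j_ge2 ltki.
  have -> : i = (i - (k - 2)) + (k - 2) by lia.
  have -> : i - (k - 2) + (k - 2) + j - 2 = (i - (k - 2) + j - 2) + (k - 2) by lia.
  rewrite !extremal_step; try lia.
  have := IHm (i - (k - 2)) j; lia.
have [le1 | gt1] := leqP n1 k; last exact: red.
have [le2 | gt2] := leqP n2 k; last by rewrite addnC [n1 + _]addnC; apply: red; lia.
by apply: extremal_superadd_low; lia.
Qed.

Lemma extremal_mono n : 2 <= n -> extremal s k n <= extremal s k n.+1.
Proof.
move=> n_ge2; apply: (leq_trans (leq_addr (extremal s k 3) _)).
have := @extremal_superadd n 3 n_ge2 isT; have -> : n + 3 - 2 = n.+1 by lia.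
by [].
Qed.

Lemma bin_central a : 2 < a -> s <= 2 * a - 1 ->
  (2 * a - 3) * 'C(a, s.-1) < 'C(2 * a - 1, s).
Proof.
case: s s_gt2 => // r r_gt1 a_gt2 ler /=.
have [c0 | c_gt0] := posnP 'C(a, r).
  by rewrite c0 muln0 bin_gt0.
have lera : r <= a by rewrite bin_gt0 in c_gt0.
have := @bin_pairs_strict r a (a - 2) r_gt1.
have -> : a - (a - 2) = 2 by lia.
have -> : a.+1 + (a - 2) = 2 * a - 1 by lia.
rewrite (@bin_small 2) // binS mulnBl -!mulnA; lia.
Qed.

Lemma bin_central_le a : 2 < a -> 2 * a <= k.+1 ->
  (k - 2) * 'C(a, s.-1) <= 'C(k, s).
Proof.
move=> a_gt2 lek.
have base : (2 * a - 3) * 'C(a, s.-1) <= 'C(2 * a - 1, s).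
  have [le | gt] := leqP s (2 * a - 1); first exact/ltnW/bin_central.
  by rewrite (@bin_small a) ?muln0 //; lia.
have -> : k = 2 * a - 1 + (k.+1 - 2 * a) by lia.
elim: (k.+1 - 2 * a) => [|d IHd]; first by rewrite addn0; have -> : 2 * a - 1 - 2 = 2 * a - 3 by lia.
rewrite addnS; case: s s_gt2 base IHd => // r _ base IHd; rewrite binS /= in base IHd *.
have := @bin_le r a (2 * a - 1 + d); have -> : (2 * a - 1 + d).+1 - 2 = (2 * a - 1 + d - 2).+1 by lia.
rewrite (mulSn (2 * a - 1 + d - 2)); lia.
Qed.

Lemma kopylov_lt_extremal n a : 2 < a -> 2 * a <= k.+1 -> k < n ->
  'C(k - a + 2, s) + (n - (k - a + 2)) * 'C(a, s.-1) < extremal s k n.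
Proof.
move=> a_gt2 lek; have [m] := ubnP n; elim: m n => // m IHm n ltnm ltkn.
have [big | small] := ltnP (k + (k - 2)) n.
  have e : n = n - (k - 2) + (k - 2) by lia.
  rewrite {2}e extremal_step; last by lia.
  have := bin_central_le a_gt2 lek; have := IHm (n - (k - 2)).
  have -> : n - (k - a + 2) = n - (k - 2) - (k - a + 2) + (k - 2) by lia.
  rewrite mulnDl; lia.
have -> : extremal s k n = 'C(n - (k - 2), s) + 'C(k, s).
  have e : n = n - (k - 2) + (k - 2) by lia.
  by rewrite {1}e extremal_step ?extremal_small //; lia.
have shift := @bin_convex s (k - a + 2) a.+1 (a - 2).
move: shift; have -> : k - a + 2 + (a - 2) = k by lia.
have -> : a.+1 + (a - 2) = 2 * a - 1 by lia.
move=> shift.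
have [les | gts] := leqP s (2 * a - 1); last first.
  rewrite (@bin_small a) ?muln0; last by lia.
  have := @bin_lt s (k - a + 2) k; lia.
have := bin_central a_gt2 les.
case: s s_gt2 shift => // r r_gt1 shift /=.
have := bin_tangent r a (n - (k - 2)).
have := shift _; rewrite binS.
have -> : n - (k - a + 2) = n - (k - 2) + (a - 2) - 2 by lia.
set c := 'C(a, r); set x := 'C(k - a + 2, _); set y := 'C(_ - 1, _).
set N := n - (k - 2); have N_ge : 3 <= N by lia.
have -> : (N + (a - 2) - 2) * c = N * c + a * c - 4 * c.
  by rewrite -mulnDl -mulnBl; congr (_ * _); lia.
have -> : (2 * a - 3) * c = 2 * (a * c) - 3 * c by rewrite mulnBl mulnA.
have : 3 * c <= a * c by rewrite leq_mul2r; lia.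
have : 3 * c <= N * c by rewrite leq_mul2r; lia.
lia.
Qed.

End Extremal.

(** * Cliques and rooted graphs *)

Section Graphs.

Variable T : finType.
Implicit Types (E : rel T) (A B Q S V H : {set T}) (x y z u v w : T).

Definition clique E S := [forall x in S, forall y in S, (x != y) ==> E x y].

Lemma cliqueP E S :
  reflect {in S &, forall x y, x != y -> E x y} (clique E S).
Proof.
apply: (iffP forall_inP) => [h x y xS yS | h x xS].
  by move/forall_inP: (h x xS) => /(_ y yS)/implyP.
by apply/forall_inP => y yS; apply/implyP; apply: h.
Qed.

Lemma cliqueS E Q S : S \subset Q -> clique E Q -> clique E S.
Proof.
by move=> /subsetP sSQ /cliqueP h; apply/cliqueP => x y /sSQ xQ /sSQ; apply: h.
Qed.

Definition cliques E V s :=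
  [set S : {set T} | [&& S \subset V, #|S| == s & clique E S]].

Lemma cliques_mono E E' V s :
  {in V &, forall x y, E x y -> E' x y} -> #|cliques E V s| <= #|cliques E' V s|.
Proof.
move=> sE; apply/subset_leq_card/subsetP => S.
rewrite !inE => /and3P[sSV -> /cliqueP cS]; rewrite sSV /=.
by apply/cliqueP => x y xS yS /(cS _ _ xS yS); apply: sE; apply: (subsetP sSV).
Qed.

Lemma cliques_split E V V1 V2 s :
    V \subset V1 :|: V2 ->
    {in V &, forall x y, x \notin V1 -> y \notin V2 -> ~~ E x y} ->
  #|cliques E V s| <= #|cliques E V1 s| + #|cliques E V2 s|.
Proof.
move=> sV noE; apply: leq_trans (leq_card_setU _ _).
apply/subset_leq_card/subsetP => S; rewrite !inE => /and3P[sSV -> cS].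
rewrite cS !andbT; have [//|/subsetPn[x xS xV1]] := boolP (S \subset V1).
apply/subsetP => y yS; apply: contraT => yV2.
have := noE x y (subsetP sSV _ xS) (subsetP sSV _ yS) xV1 yV2.
move/cliqueP: cS => /(_ x y xS yS) -> //; apply: contraNneq xV1 => xy.
by have := subsetP sV y (subsetP sSV _ yS); rewrite !inE (negPf yV2) orbF xy.
Qed.

Lemma cliques_del E V x s :
  #|cliques E V s| <= #|cliques E (V :\ x) s| + 'C(#|[set y in V | E x y]|, s.-1).
Proof.
rewrite -(cardsID [set S : {set T} | x \in S]) addnC; apply: leq_add.
  apply/subset_leq_card/subsetP => S.
  rewrite !inE => /andP[xS /and3P[sSV -> ->]]; rewrite !andbT.
  by rewrite subsetD1 sSV.
set N := [set y in V | E x y]; rewrite -cards_draws.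
rewrite -(card_in_imset (f := fun S => S :\ x)); last first.
  move=> S S'; rewrite !inE => /andP[_ xS] /andP[_ xS'] eqS.
  by rewrite -(setD1K xS) -(setD1K xS') eqS.
apply/subset_leq_card/subsetP => _ /imsetP[S + ->].
rewrite !inE => /andP[/and3P[sSV /eqP <- /cliqueP cS] xS].
rewrite (cardsD1 x S) xS /= eqxx andbT; apply/subsetP => y.
rewrite !inE => /andP[yx yS]; rewrite (subsetP sSV) //=.
by apply: cS => //; rewrite eq_sym.
Qed.

Lemma cliques_le E V s : #|cliques E V s| <= 'C(#|V|, s).
Proof.
rewrite -cards_draws; apply/subset_leq_card/subsetP => S.
by rewrite !inE => /and3P[-> ->].
Qed.

Lemma cliques_full E V s : 2 <= s <= #|V| ->
  #|cliques E V s| = 'C(#|V|, s) -> clique E V.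
Proof.
move=> /andP[s_ge2 les] eqN.
have {}eqN : cliques E V s = [set S : {set T} | S \subset V & #|S| == s].
  apply/eqP; rewrite eqEcard cards_draws eqN leqnn andbT.
  by apply/subsetP => S; rewrite !inE => /and3P[-> ->].
apply/cliqueP => x y xV yV xy.
have : s - 2 <= #|V :\: [set x; y]|.
  by rewrite cardsDS ?subUset ?sub1set ?xV // cards2 xy leq_sub2r.
case/card_geqP=> r [r_uniq r_size r_sub].
pose S := [set x; y] :|: [set z in r].
have r_out z : z \in r -> z \in V :\: [set x; y] by exact: r_sub.
have : S \in cliques E V s.
  rewrite eqN inE; apply/andP; split.
    rewrite !subUset !sub1set xV yV /=; apply/subsetP => z.
    by rewrite inE => /r_out; rewrite inE => /andP[].
  rewrite cardsU disjoint_setI0 ?cards0; last first.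
    rewrite disjoint_sym; apply/pred0P => z /=; rewrite !inE.
    by apply/negP => /andP[/r_out]; rewrite !inE => /andP[/negP].
  by rewrite cards2 xy cardsE (card_uniqP r_uniq) r_size subn0 addnC subnK.
rewrite inE => /and3P[_ _ /cliqueP]; apply=> //; by rewrite !inE eqxx ?orbT.
Qed.

(* For adjacent u and v, this says that no vertex x separates V: every
   component of V \ {x} meets {u, v}. *)
Definition linked E V u v := forall x S, S != set0 -> S \subset V :\: [set u; v; x] ->
  exists a b, [/\ a \in S, b \in V :\: S, b != x & E a b].

Definition connected_on E H := forall S, S != set0 -> S \proper H ->
  exists a b, [/\ a \in S, b \in H :\: S & E a b].

Definition bounded E V u v k := forall p,
  path E u p -> last u p = v -> uniq (u :: p) -> {subset p <= V} -> size p < k.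

Record rooted E V u v k : Prop := Rooted {
  rsym : symmetric E; rirr : irreflexive E;
  ru : u \in V; rv : v \in V; ruv : E u v;
  rlinked : linked E V u v;
  rbounded : bounded E V u v k }.

Lemma path_rev E a x l : symmetric E ->
  path E a (rev (x :: l)) = E a (last x l) && path E x l.
Proof.
move=> symE; rewrite lastI rev_rcons /= rev_path; congr (_ && _).
by apply: eq_path => y z; rewrite symE.
Qed.

Lemma last_rev a x l : last a (rev (x :: l)) = x.
Proof. by rewrite rev_cons last_rcons. Qed.

Lemma rooted_neq E V u v k : rooted E V u v k -> u != v.
Proof. by move=> [_ irr _ _ uv _ _]; apply: contraTneq uv => ->; rewrite irr. Qed.

Lemma rooted_sym E V u v k : rooted E V u v k -> rooted E V v u k.
Proof.
move=> G; have [symE irr uV vV uv lk bd] := G; split=> //; first by rewrite symE.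
  by move=> x S S0 sS; apply: lk => //; rewrite (setUC [set u]).
elim/last_ind=> [|q y _]; first by move=> _ /= vu; rewrite vu irr in uv.
rewrite last_rcons rcons_path => /andP[pq Eyu] yu un sV; subst y.
have := bd (rev (v :: q)); rewrite path_rev // pq symE Eyu size_rev size_rcons.
apply=> //; first by rewrite last_rev.
  by rewrite -rev_rcons rev_uniq -rcons_cons rcons_uniq in un *.
by move=> y; rewrite mem_rev inE => /predU1P[->|yq] //; apply: sV; rewrite mem_rcons inE yq orbT.
Qed.

Lemma reach E A B z : z \in A :\: B ->
    (forall S, z \in S -> S \subset A :\: B ->
       exists a b, [/\ a \in S, b \in A :\: S & E a b]) ->
  exists p b, [/\ path E z (rcons p b), uniq (z :: rcons p b),
                 {subset p <= A :\: B} & b \in A :&: B].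
Proof.
move=> zAB h; pose e := [rel x y | E x y && (y \in A :\: B)].
pose R := [set y | connect e z y].
have sR : R \subset A :\: B.
  apply/subsetP => y; rewrite inE => /connectP[p]; elim/last_ind: p => [|p y' _].
    by move=> _ ->.
  by rewrite rcons_path last_rcons => /andP[_ /andP[_ ?]] ->.
have [|a [b [aR bA Eab]]] := h R _ sR; first by rewrite inE connect0.
have bB : b \in B.
  apply: contraT => bB; move: (bA); rewrite inE => /andP[/negP bR bA'].
  case: bR; move: aR; rewrite !inE => aR; apply: connect_trans aR (connect1 _).
  by rewrite /= Eab inE bB bA'.
move: aR; rewrite inE => /connectP[p0 p0path aE].
case/shortenP: p0path aE => p ppath puniq _ aE; exists p, b.
have sp : {subset p <= A :\: B}.
  move=> y yp; apply: (subsetP sR); rewrite inE.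
  by apply/connectP; case/splitPr: yp ppath => p1 p2; rewrite -cat_rcons cat_path => /andP[? _];
     exists (rcons p1 y); rewrite ?last_rcons.
split => //.
- rewrite rcons_path -aE Eab andbT; apply: sub_path ppath => x y /=.
  by case/andP.
- rewrite -rcons_cons rcons_uniq puniq andbT; apply/negP; rewrite inE => /predU1P[bz|/sp].
    by move: zAB; rewrite -bz inE bB.
  by rewrite inE bB.
by move: bA; rewrite !inE bB => /andP[_ ->].
Qed.

End Graphs.

Section Graphs.

Variable T : finType.
Implicit Types (E : rel T) (A B Q S V H : {set T}) (x y z u v w : T).

Lemma clique_path E Q x p :
  clique E Q -> uniq (x :: p) -> {subset x :: p <= Q} -> path E x p.
Proof.
move=> /cliqueP cQ; elim: p x => //= y p IHp x /and3P[xyp yp up] sQ.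
rewrite IHp ?yp // => [|z zp]; last by apply: sQ; rewrite inE zp orbT.
rewrite andbT; apply: cQ; rewrite ?sQ ?inE ?eqxx ?orbT //.
by apply: contraNneq xyp => ->; rewrite inE eqxx.
Qed.

Lemma no_clique_aux E V u v k Q y z p q : rooted E V u v k ->
    Q \subset V -> u \in Q -> v \in Q -> clique E Q -> k <= #|Q| ->
    y \in Q :\: [set u; v] -> E y z -> path E z (rcons p q) ->
    uniq (z :: rcons p q) -> {subset z :: p <= V :\: Q} -> q \in Q :\ y -> q != u ->
  False.
Proof.
move=> G sQV uQ vQ cQ lek; rewrite !inE negb_or -andbA => /and3P[yu yv yQ] Eyz zpq un szp.
move=> /andP[qy qQ] qu.
pose rest := enum (Q :\: [set u; v; y; q]).
pose tail := if q == v then [::] else [:: v].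
have uv := rooted_neq G.
have lastq : last q tail = v by rewrite /tail; case: eqP.
have Eqt : path E q tail.
  rewrite /tail; have [//|qv /=] := eqVneq q v; rewrite andbT.
  by move/cliqueP: cQ; apply.
have mem_tail t : (t \in tail) = (t == v) && (q != v).
  by rewrite /tail; case: eqVneq => _; rewrite ?inE ?andbT ?andbF.
have restP t : t \in rest = [&& t != u, t != v, t != y, t != q & t \in Q].
  by rewrite mem_enum !inE !negb_or -!andbA.
have szpP t : t \in z :: p -> (t \in V) * (t \in Q = false).
  by move/szp; rewrite inE => /andP[/negPf-> ->].
have un_rest : uniq (u :: rcons rest y).
  by rewrite /= rcons_uniq mem_rcons inE !restP !eqxx !andbF eq_sym (negPf yu) enum_uniq.
have un2 : uniq (z :: p ++ q :: tail).
  rewrite -cat_rcons -cat_cons cat_uniq un.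
  have -> : uniq tail by rewrite /tail; case: ifP.
  rewrite andbT /=; apply/hasPn => t; rewrite mem_tail => /andP[/eqP-> qv].
  rewrite -rcons_cons mem_rcons in_cons eq_sym (negPf qv) /=.
  by apply/negP => /szpP[_]; rewrite vQ.
have size_big : k <= size (rest ++ y :: z :: p ++ q :: tail).
  have cQ' : #|Q| <= size rest + (3 + (q != v)).
    rewrite -cardE -(cardsID [set u; v; y; q] Q) addnC leq_add2l.
    apply: leq_trans (subset_leq_card (subsetIr _ _)) _.
    rewrite setUC cardsU1 addnC leq_add //; last first.
      by rewrite !inE (negPf qu) (negPf qy) orbF.
    by rewrite setUC cardsU1 cards2; case: (y \notin _); case: (u != v).
  rewrite size_cat /= size_cat /= (leq_trans (leq_trans lek cQ')) // /tail.
  case: eqP => _ /=; rewrite leq_add2l !addnS !addn0 /= !ltnS ?addn1 //.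
suff: size (rest ++ y :: z :: p ++ q :: tail) < k by rewrite ltnNge size_big.
apply: (rbounded G).
- rewrite -cat_rcons cat_path last_rcons /= Eyz -cat_rcons cat_path zpq last_rcons Eqt !andbT.
  apply: clique_path cQ un_rest _ => t; rewrite inE mem_rcons inE restP.
  by case/or3P=> [/eqP->|/eqP->|/and5P[]].
- by rewrite last_cat /= last_cat.
- rewrite -cat_rcons -cat_cons cat_uniq un_rest un2 andbT andTb.
  apply/hasPn => t; rewrite -cat_cons mem_cat => /orP[/szpP[_ tQ]|].
    apply/negP; rewrite inE mem_rcons inE restP tQ !andbF orbF.
    by case/orP=> /eqP tE; rewrite tE ?uQ ?yQ in tQ.
  rewrite inE mem_tail => /predU1P[->|/andP[/eqP-> qv]].
    by rewrite inE mem_rcons inE restP (negPf qu) (negPf qy) eqxx !andbF.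
  by rewrite inE mem_rcons inE restP eqxx !andbF !orbF eq_sym (negPf uv) eq_sym (negPf yv).
- move=> t; rewrite mem_cat restP !inE => /orP[/and5P[_ _ _ _ /(subsetP sQV)]//|].
  case/predU1P=> [->|]; first exact: (subsetP sQV).
  rewrite -in_cons -cat_cons mem_cat => /orP[/szpP[]//|]; rewrite inE mem_tail.
  by case/predU1P=> [->|/andP[/eqP-> _]]; apply: (subsetP sQV).
Qed.

Lemma no_clique E V u v k Q : rooted E V u v k -> connected_on E (V :\: [set u; v]) ->
    2 < k -> k < #|V| -> Q \subset V -> u \in Q -> v \in Q -> clique E Q ->
  #|Q| != k.
Proof.
move=> G cH k_gt2 ltkV sQV uQ vQ cQ; apply/negP => /eqP cardQ.
have uv := rooted_neq G.
have [|| y [z [yS zH Eyz]]] := cH (Q :\: [set u; v]).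
- rewrite -card_gt0 cardsDS ?subUset ?sub1set ?uQ // cards2 uv cardQ; lia.
- rewrite properE setSD //=; apply/subsetPn.
  have /subsetPn[t tV tQ] : ~~ (V \subset Q).
    by apply: contraL ltkV => /subset_leq_card; rewrite cardQ -leqNgt.
  exists t; last by rewrite inE (negPf tQ) andbF.
  rewrite !inE tV andbT; apply: contra tQ; by case/orP=> /eqP->.
have zVQ : z \in V :\: Q.
  by move: zH; rewrite !inE !negb_and !negb_or; case: eqP => //=; case: eqP.
have yQ : y \in Q by case/setDP: yS.
have [||p [q [zpq un sp qQ]]] := @reach T E (V :\ y) Q z.
- by move: zVQ; rewrite !inE => /andP[zQ ->]; rewrite zQ (contraNneq _ zQ) // => ->.
- move=> S zS sS; have [||a [b [aS bS ba Eab]]] := rlinked G (x := y) (S := S).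
  + by apply/set0Pn; exists z.
  + apply: subset_trans sS _; apply/subsetP => t; rewrite !inE.
    case/and3P=> tQ /negPf-> ->; rewrite orbF andbT; apply: contra tQ.
    by case/orP=> /eqP->.
  by exists a, b; split=> //; move: bS; rewrite !inE ba.
have szp : {subset z :: p <= V :\: Q}.
  by move=> t; rewrite inE => /predU1P[->//|/sp]; rewrite !inE => /and3P[-> _ ->].
have qQy : q \in Q :\ y by move: qQ; rewrite !inE => /andP[/andP[-> _] ->].
have [qu | qu] := eqVneq q u; last first.
  by apply: (no_clique_aux G sQV uQ vQ cQ _ yS Eyz zpq un szp qQy qu); rewrite cardQ.
have qv : q != v by rewrite qu.
apply: (no_clique_aux (rooted_sym G) sQV vQ uQ cQ _ _ Eyz zpq un szp qQy qv).
  by rewrite cardQ.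
by rewrite setUC.
Qed.

End Graphs.

(** * Posa's lemma for two disjoint paths *)

Lemma split_last_has (T : Type) (P : pred T) s : has P s ->
  exists s1 a s2, [/\ s = s1 ++ a :: s2, P a & ~~ has P s2].
Proof.
elim: s => //= a s IHs; have [hs _|hs] := boolP (has P s).
  have [s1 [b [s2 [-> Pb ns2]]]] := IHs hs.
  by exists (a :: s1), b, s2.
by rewrite orbF => Pa; exists [::], a, s.
Qed.

Lemma count_alternating (T : Type) (P Q : pred T) a s :
    path (fun b c => ~~ (Q b && P c)) a s ->
  count P s + count Q s + Q a <= size s + Q (last a s).
Proof.
elim: s a => [|b s IHs] a //= /andP[QaPb /IHs].
by move: QaPb; case: (Q a); case: (P b) => //=; lia.
Qed.

Lemma path_by_splits (T : Type) (R : rel T) a s :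
    (forall s1 b c s2, a :: s = s1 ++ b :: c :: s2 -> R b c) -> path R a s.
Proof.
elim: s a => //= b s IHs a h; rewrite (h [::] a b s) //=.
by apply: IHs => s1 c d s2 eqs; apply: (h (a :: s1) c d s2); rewrite eqs.
Qed.

Lemma perm_reroute (T : eqType) (x y b c : T) s1 s2 r :
  perm_eq (rev s2 ++ c :: x :: s1 ++ b :: y :: r) (x :: (s1 ++ b :: c :: s2) ++ y :: r).
Proof.
apply/permP => P; rewrite /= !(count_cat, count_rev) /= !count_cat /=.
lia.
Qed.

Section Graphs.

Variable T : finType.
Implicit Types (E : rel T) (A B Q S V H X Y : {set T}) (x y z u v w : T).

Lemma sorted_rev_cat E s a t : symmetric E ->
  sorted E (rev s ++ a :: t) = path E a s && path E a t.
Proof.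
move=> symE; rewrite -cat_rcons -rev_cons lastI rev_rcons /= cat_path.
rewrite rev_path; congr (_ && _); first by apply: eq_path => y z; rewrite symE.
by congr (path E _ t); case: s => [|b s] //=; rewrite rev_cons last_rcons.
Qed.

Definition pathfree E H l := forall s,
  sorted E s -> uniq s -> {subset s <= H} -> size s <= l.

(* Starting from [a], one can run through all neighbours of the end [x] of the path
   by leaving [x :: p] at the last neighbour of [x] beyond [a] and re-entering at [x]. *)
Lemma cover_nbrs E x p a : symmetric E -> path E x p -> uniq (x :: p) -> a \in x :: p ->
  exists q, [/\ path E a q, uniq (a :: q), {subset a :: q <= x :: p}
    & {subset x :: filter (E x) p <= a :: q}].
Proof.
move=> symE; rewrite inE => pp un /predU1P[->|ap].
  exists p; split=> // t; rewrite !inE mem_filter; case: eqP => //= _.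
  by case/andP.
case/splitPr: ap pp un => l1 l2; rewrite cat_path => /andP[pl1 /andP[Ela pl2]] un.
have un1 : uniq (a :: l2 ++ x :: l1).
  by move: un; rewrite -cat_cons uniq_catC.
have [hx | nx] := boolP (has (E x) (a :: l2)); last first.
  exists (rev (x :: l1)); split.
  - by rewrite path_rev // symE Ela.
  - move: un; rewrite -cat_rcons -cat_cons cat_uniq => /andP[+ _].
    by rewrite -rcons_cons -rev_uniq rev_rcons.
  - move=> t; rewrite inE mem_rev !inE mem_cat inE.
    by case/or3P=> ->; rewrite ?orbT.
  move=> t; rewrite [in X in _ -> X]inE mem_rev !inE mem_filter mem_cat inE.
  case/predU1P=> [->|/andP[Ext]]; first by rewrite eqxx orbT.
  case/or3P=> [->|->|tl2]; rewrite ?orbT //.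
  by case/hasP: nx; exists t; rewrite ?inE ?tl2 ?orbT.
have [s1 [f [s2 [eqs Exf ns2]]]] := split_last_has hx.
have sub2 : {subset s1 ++ f :: x :: l1 <= x :: l1 ++ a :: l2}.
  move=> t; rewrite -cat_cons mem_cat eqs !(mem_cat, inE).
  by case/or4P=> ->; rewrite ?orbT.
have un2 : uniq (s1 ++ f :: x :: l1).
  move: un1; rewrite -cat_cons eqs -catA; apply: subseq_uniq.
  by apply: cat_subseq => //; rewrite /= eqxx; apply: suffix_subseq.
have incl : {subset x :: filter (E x) (l1 ++ a :: l2) <= s1 ++ f :: x :: l1}.
  move=> t; rewrite inE mem_filter eqs !(mem_cat, inE).
  case/predU1P=> [->|/andP[Ext]]; first by rewrite eqxx !orbT.
  case/or4P=> [->|->|->|ts2]; rewrite ?orbT //.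
  by case/hasP: ns2; exists t.
have pth : sorted E (s1 ++ f :: x :: l1).
  have : sorted E (s1 ++ f :: s2) by rewrite -eqs.
  rewrite -2!cat_rcons; case: s1 {eqs sub2 un2 incl} => [|b s1] /=.
    by rewrite symE Exf pl1.
  by rewrite !cat_path !rcons_path !last_rcons /= => /andP[/andP[-> ->] _];
     rewrite symE Exf pl1.
move: eqs pth sub2 un2 incl; case: s1 => [|b s1] /= [-> _] pth sub2 un2 incl.
  by exists (x :: l1).
by exists (s1 ++ f :: x :: l1).
Qed.

Section Posa.

Variables (E : rel T) (H : {set T}) (l : nat).
Hypotheses (symE : symmetric E) (irrE : irreflexive E) (cH : connected_on E H) (free : pathfree E H l).

Record config x p y r : Prop := Config {
  cfg_x : path E x p; cfg_y : path E y r; cfg_uniq : uniq (x :: p ++ y :: r);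
  cfg_sub : {subset x :: p ++ y :: r <= H}; cfg_E : ~~ E x y;
  cfg_big : l < size (x :: p ++ y :: r) }.

Lemma config_sym x p y r : config x p y r -> config y r x p.
Proof.
move=> [xp yr un sub nE big]; split=> //; first by rewrite -cat_cons uniq_catC.
- by move=> t; rewrite -cat_cons mem_cat orbC -mem_cat; apply: sub.
- by rewrite symE.
- by move: big; rewrite -cat_cons size_cat addnC -size_cat.
Qed.

Lemma no_full_path x p y r s : config x p y r -> perm_eq s (x :: p ++ y :: r) ->
  ~~ sorted E s.
Proof.
move=> [xp yr un sub nE big] eqs; apply: contraL big => ss; rewrite -leqNgt.
rewrite -(perm_size eqs); apply: free => //; first by rewrite (perm_uniq eqs).
by move=> t; rewrite (perm_mem eqs); apply: sub.
Qed.

Lemma config_alternating x p y r : config x p y r ->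
  path (fun b c => ~~ (E y b && E x c)) x p /\ ~~ E y (last x p).
Proof.
move=> cfg; have [xp yr un sub nE big] := cfg; split; last first.
  apply: contraL (no_full_path cfg (perm_refl _)) => Eyl; rewrite negbK /=.
  by rewrite cat_path xp /= symE Eyl.
apply: path_by_splits => -[|x' s1] b c s2 /=.
  by case=> <- _; rewrite symE (negPf nE).
case=> _ eqp; apply: contraL (no_full_path cfg (s := rev s2 ++ c :: x :: s1 ++ b :: y :: r) _).
  case/andP=> Eyb Exc; rewrite negbK sorted_rev_cat //.
  move: xp; rewrite eqp cat_path /= => /and4P[ps1 Eb Ebc pcs2].
  by rewrite pcs2 /= symE Exc cat_path ps1 /= Eb symE Eyb.
by rewrite eqp perm_reroute.
Qed.

(* Take the last neighbour of [y] on [p] and the next neighbour of [x] after it: the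
   path obtained by crossing over there omits only the vertices in between. *)
Lemma posa_crossing x p y r : config x p y r -> has (E y) p ->
  count (E x) (p ++ r) + count (E y) (p ++ r) < l.
Proof.
move=> cfg hy; have [xp yr un sub nE big] := cfg.
have [alt _] := config_alternating cfg.
have [alt' last'] := config_alternating (config_sym cfg).
have := count_alternating alt'; rewrite (negPf last') (negPf nE) !addn0 => cnt_r.
have [s1 [f [rest [eqp Eyf /hasPn ny]]]] := split_last_has hy.
set l1 := rcons s1 f; have eqp' : p = l1 ++ rest by rewrite cat_rcons.
have := alt; rewrite eqp' cat_path => /andP[alt1 _].
have := count_alternating alt1.
rewrite last_rcons Eyf symE (negPf nE) addn0 => cnt_l1.
have cnt_rest : count (E y) rest = 0.
  by apply/eqP; rewrite -leqn0 leqNgt -has_count; apply/hasPn.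
set i := find (E x) rest; set l2 := take i rest; set l3 := drop i rest.
have eqr : rest = l2 ++ l3 by rewrite cat_take_drop.
have cnt_l2 : count (E x) l2 = 0.
  apply/eqP; rewrite -leqn0 leqNgt -has_count has_take_leq ?ltnn //.
  exact: find_size.
have cnt_l3 := count_size (E x) l3.
suff: size l3 + (size l1).+1 + (size r).+1 <= l.
  rewrite !count_cat cnt_rest eqr count_cat cnt_l2; move: cnt_l1 cnt_r cnt_l3.
  clear; lia.
have W : sorted E (rev l3 ++ x :: l1 ++ y :: r).
  move: xp; rewrite eqp' cat_path => /andP[pl1 prest].
  have tailP : path E x (l1 ++ y :: r).
    by rewrite cat_path pl1 last_rcons /= symE Eyf.
  case e3 : l3 => [|c l3'] //.
  have ltir : i < size rest.
    by rewrite ltnNge; apply/negP=> /drop_oversize; rewrite -/l3 e3.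
  have Exc : E x c.
    have hr : has (E x) rest by rewrite has_find.
    by have := nth_find x hr; rewrite -/i -[i]addn0 -nth_drop -/l3 e3.
  rewrite rev_cons cat_rcons sorted_rev_cat //= symE Exc tailP andbT.
  by rewrite andbT; move: prest; rewrite eqr cat_path e3 /= => /and3P[].
suff: size (rev l3 ++ x :: l1 ++ y :: r) <= l.
  by rewrite !(size_cat, size_rev) /= ?size_cat /= !(addSn, addnS) addnA.
apply: free W _ _.
- rewrite uniq_catC -cat_cons -!catA.
  apply: (@subseq_uniq _ _ (x :: l1 ++ l2 ++ y :: r ++ rev l3)).
    rewrite -cat_cons; apply: cat_subseq; first exact: subseq_refl.
    exact: (suffix_subseq l2).
  move: un; rewrite eqp' eqr.
  suff /perm_uniq -> : perm_eq (x :: (l1 ++ l2 ++ l3) ++ y :: r)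
     (x :: l1 ++ l2 ++ y :: r ++ rev l3) by [].
  rewrite perm_cons -!catA !perm_cat2l -cat_cons perm_catC perm_cat2l.
  by rewrite perm_sym perm_rev.
- move=> t; rewrite !(mem_cat, mem_rev, inE) => tin; apply: sub.
  rewrite eqp' eqr !(inE, mem_cat); move: tin.
  by case/or4P=> [|||/orP[]] ->; rewrite ?orbT.
Qed.

(* Without crossing, a path linking the two paths lets one traverse all neighbours
   of [x] and all neighbours of [y]. *)
Lemma posa_bridge x p y r : config x p y r -> ~~ has (E y) p -> ~~ has (E x) r ->
  count (E x) (p ++ r) + count (E y) (p ++ r) < l.
Proof.
move=> [xp yr un sub nE big] nyp nxr.
have [unx [ndis uny]] : uniq (x :: p) /\ ~~ has (mem (x :: p)) (y :: r) /\ uniq (y :: r).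
  by move: un; rewrite -cat_cons cat_uniq => /and3P[].
have xH : x \in H by apply: sub; rewrite inE eqxx.
have yH : y \in H by apply: sub; rewrite !(inE, mem_cat) eqxx !orbT.
pose B := [set t in y :: r].
have [||s [b [xsb uns ss bB]]] := @reach T E H B x.
- rewrite inE xH andbT inE; apply: contraL ndis => xB; rewrite negbK.
  by apply/hasP; exists x; rewrite //= inE eqxx.
- move=> S xS sS; apply: cH; first by apply/set0Pn; exists x.
  rewrite properE (subset_trans sS (subsetDl _ _)); apply/subsetPn; exists y => //.
  by apply/negP => /(subsetP sS); rewrite !inE eqxx.
have hasx : has (mem (x :: p)) (x :: s) by rewrite /= inE eqxx.
have [s1 [a [s2 [eqs axp /hasPn ns2]]]] := split_last_has hasx.
have pa : path E a (rcons s2 b).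
  have : sorted E (x :: rcons s b) by [].
  rewrite -rcons_cons eqs rcons_cat rcons_cons; case: s1 {eqs} => [//|c s1] /=.
  by rewrite cat_path /= => /and3P[].
have us2 : uniq s2.
  move: uns; rewrite -rcons_cons rcons_uniq eqs cat_uniq /=.
  by case/andP=> _ /and4P[].
have s2out t : t \in s2 -> (t \in H) * (t \in x :: p = false) * (t \in y :: r = false).
  move=> ts2; have tx := negPf (ns2 t ts2).
  have : t \in x :: s by rewrite eqs mem_cat inE ts2 !orbT.
  rewrite inE => /predU1P[tx'|/ss]; first by move: tx; rewrite tx' /= inE eqxx.
  by rewrite !inE => /andP[/negPf nty ->]; rewrite nty; move: tx; rewrite /= inE => ->.
have byr : b \in y :: r by move: bB; rewrite !inE => /andP[].
have [q [paq uq sq cq]] := cover_nbrs symE xp unx axp.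
have [q' [pbq' uq' sq' cq']] := cover_nbrs symE yr uny byr.
have W : sorted E (rev q ++ a :: s2 ++ b :: q').
  rewrite sorted_rev_cat // paq -cat_rcons cat_path pa last_rcons pbq'.
  by [].
have permW : perm_eq (rev q ++ a :: s2 ++ b :: q') ((a :: q) ++ s2 ++ b :: q').
  by rewrite -cat_rcons -rev_cons perm_cat2r perm_rev.
have : size (rev q ++ a :: s2 ++ b :: q') <= l.
  apply: free W _ _.
    rewrite (perm_uniq permW) cat_uniq uq cat_uniq us2 uq' andTb andbT.
    apply/andP; split; apply/hasPn => t.
      rewrite mem_cat => /orP[/s2out[[_ tx] _]|/sq' tyr].
        by apply/negP => /sq; rewrite tx.
      apply/negP => /sq txp; case/hasP: ndis; exists t => //.
    by move=> /sq' tyr; apply/negP => /s2out[_]; rewrite tyr.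
  move=> t; rewrite (perm_mem permW) !mem_cat => /or3P[/sq tx|/s2out[[]]|/sq' ty] //.
    by apply: sub; rewrite -cat_cons mem_cat tx.
  by apply: sub; rewrite -cat_cons mem_cat ty orbT.
rewrite (perm_size permW) !size_cat; apply: leq_trans.
have cnt0 z (m : seq T) : ~~ has (E z) m -> count (E z) m = 0.
  by rewrite has_count -leqNgt leqn0 => /eqP.
rewrite !count_cat (cnt0 _ _ nyp) (cnt0 _ _ nxr) addn0 add0n.
have i1 : (count (E x) p).+1 <= size (a :: q).
  rewrite -size_filter; apply: (uniq_leq_size (s1 := x :: _) _ cq).
  by move: unx => /= /andP[xp' up]; rewrite mem_filter (negPf xp') andbF filter_uniq.
have i2 : (count (E y) r).+1 <= size (b :: q').
  rewrite -size_filter; apply: (uniq_leq_size (s1 := y :: _) _ cq').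
  by move: uny => /= /andP[yr' ur]; rewrite mem_filter (negPf yr') andbF filter_uniq.
move: i1 i2; move: (size (a :: q)) (size (b :: q')) (count _ _) (count _ _) (size s2).
clear; lia.
Qed.

Lemma posa x p y r : config x p y r ->
  count (E x) (p ++ r) + count (E y) (p ++ r) < l.
Proof.
move=> cfg; have [hy | ny] := boolP (has (E y) p); first exact: posa_crossing.
have [hx | nx] := boolP (has (E x) r); last exact: posa_bridge.
have := posa_crossing (config_sym cfg) hx.
by rewrite !count_cat; clear; lia.
Qed.

(* Along a longest pair of disjoint paths, all neighbours of [x] in [X] and of [y]
   in [Y] lie on the paths, as otherwise the pair could be prolonged. *)
Lemma core_pair X Y x y al be :
    {subset X <= H} -> {subset Y <= H} ->
    (forall z t, z \in H -> t \in H -> z != t -> ~~ E z t -> exists p r, config z p t r) ->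
    {in X, forall z, al <= #|[set t in X | E z t]|} ->
    {in Y, forall z, be <= #|[set t in Y | E z t]|} ->
    x \in X -> y \in Y -> x != y -> ~~ E x y ->
  al + be < l.
Proof.
move=> sXH sYH emax degX degY xX yY xy nE.
have [p [r cfg]] := emax x y (sXH _ xX) (sYH _ yY) xy nE.
have [m] := ubnP (#|H| - size (x :: p ++ y :: r)).
elim: m x p y r xX yY xy nE cfg => // m IHm x p y r xX yY xy nE cfg ltm.
have leH z q t s : config z q t s -> size (z :: q ++ t :: s) <= #|H|.
  by case=> _ _ un sub _ _; rewrite cardE; apply: uniq_leq_size => // w /sub; rewrite mem_enum.
have grow z q t s w : config z q t s -> E z w -> w \in H -> w \notin z :: q ++ t :: s ->
    config w (z :: q) t s.
  move=> cfg' Ezw wH wP; have [zq ts un sub nzt big] := cfg'; split=> //.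
  - by rewrite /= symE Ezw.
  - by rewrite cons_uniq wP.
  - by move=> v; rewrite inE => /predU1P[->|/sub].
  - apply: contraL big => Ewt; rewrite -leqNgt.
    have: size (rev (z :: q) ++ w :: t :: s) <= l.
      have pm : perm_eq (rev (z :: q) ++ w :: t :: s) (w :: (z :: q) ++ t :: s).
        by rewrite perm_sym -cat1s perm_catCA perm_cat2r perm_sym perm_rev.
      apply: free; first by rewrite sorted_rev_cat //= symE Ezw zq Ewt ts.
        by rewrite (perm_uniq pm) cons_uniq wP.
      by move=> v; rewrite (perm_mem pm) inE => /predU1P[->|/sub].
    by rewrite size_cat size_rev /= !size_cat /= addnS; apply: ltnW.
  - exact: ltn_trans big _.
have dec z q t s w : config z q t s -> config w (z :: q) t s ->
    #|H| - size (z :: q ++ t :: s) < m.+1 -> #|H| - size (w :: (z :: q) ++ t :: s) < m.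
  move=> _ /leH; rewrite /=; clear; lia.
have degP z q t s A d : config z q t s -> d <= #|[set w in A | E z w]| ->
    {subset [set w in A | E z w] <= z :: q ++ t :: s} -> d <= count (E z) (q ++ s).
  case=> _ _ un sub nE' _ led subA; apply: leq_trans led _.
  rewrite -size_filter cardE; apply: uniq_leq_size; first exact: enum_uniq.
  move=> w; rewrite mem_enum => wA; have := subA w wA; move: wA; rewrite inE => /andP[_ Ezw].
  rewrite inE mem_filter Ezw /= !mem_cat inE; case: eqVneq Ezw => [->|_]; first by rewrite irrE.
  by case: eqVneq => // -> Ezt; rewrite Ezt in nE'.
have [subx | /subsetPn[w]] := boolP ([set t in X | E x t] \subset x :: p ++ y :: r); last first.
  rewrite inE => /andP[wX Exw] wP; have wH := sXH _ wX.
  have cfg' := grow _ _ _ _ _ cfg Exw wH wP.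
  apply: (IHm _ _ _ _ wX yY _ (cfg_E cfg') cfg' (dec _ _ _ _ _ cfg cfg' ltm)).
  by apply: contraNneq wP => ->; rewrite !(inE, mem_cat) eqxx !orbT.
have [suby | /subsetPn[w]] := boolP ([set t in Y | E y t] \subset y :: r ++ x :: p); last first.
  rewrite inE => /andP[wY Eyw] wP; have wH := sYH _ wY.
  have cfgs := config_sym cfg.
  have cfg' := grow _ _ _ _ _ cfgs Eyw wH wP.
  have cfg'' := config_sym cfg'.
  apply: (IHm _ _ _ _ xX wY _ (cfg_E cfg'') cfg''); last first.
    have : size (x :: p ++ w :: y :: r) <= #|H| by apply: leH cfg''.
    by move: ltm; rewrite /= !size_cat /=; clear; lia.
  by rewrite eq_sym; apply: contraNneq wP => ->; rewrite !(inE, mem_cat) eqxx !orbT.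
have hx := degP _ _ _ _ _ _ cfg (degX _ xX) (subsetP subx).
have hy := degP _ _ _ _ _ _ (config_sym cfg) (degY _ yY) (subsetP suby).
move: hx hy (posa cfg); rewrite !count_cat; clear; lia.
Qed.


End Posa.

End Graphs.

(** * Kopylov's bound for connected graphs without long paths *)

Section Graphs.

Variable T : finType.
Implicit Types (E : rel T) (A B C W Q S V H X Y : {set T}) (x y z u v w : T).

Definition add_pair E x y : rel T := fun a b =>
  E a b || (x != y) && ((a == x) && (b == y) || (a == y) && (b == x)).

Lemma add_pair_sym E x y : symmetric E -> symmetric (add_pair E x y).
Proof.
move=> symE a b; rewrite /add_pair symE; congr (_ || (_ && _)).
by rewrite orbC andbC [(_ == y) && _]andbC.
Qed.

Lemma add_pair_irr E x y : irreflexive E -> irreflexive (add_pair E x y).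
Proof.
move=> irrE a; rewrite /add_pair irrE /=; case: eqVneq => //= xy.
by case: eqVneq => //= [->|]; rewrite ?andbF ?orbF ?(negPf xy).
Qed.

Definition long_path E H l :=
  [exists s : l.+1.-tuple T, [&& sorted E s, uniq s & all (mem H) s]].

Lemma pathfreeP E H l : reflect (pathfree E H l) (~~ long_path E H l).
Proof.
apply: (iffP idP) => [|free]; last first.
  apply/existsP => -[s /and3P[ss us /allP sH]].
  by have := free s ss us sH; rewrite size_tuple ltnn.
move=> /existsPn nolong s ss us sH; rewrite leqNgt; apply/negP => lts.
have sz : size (take l.+1 s) == l.+1 by rewrite size_takel.
have /negP[] := nolong (Tuple sz) => /=; apply/and3P; split.
- exact: take_sorted.
- exact: take_uniq.
- by apply/allP => t /mem_take /sH.
Qed.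

Lemma not_sorted_split (R : rel T) s : ~~ sorted R s ->
  exists s1 b c s2, s = s1 ++ b :: c :: s2 /\ ~~ R b c.
Proof.
elim: s => //= a [|b s] //= IHs; have [Rab /= /IHs|nR _] := boolP (R a b).
  by case=> s1 [c [d [s2 [-> nR]]]]; exists (a :: s1), c, d, s2.
by exists [::], a, b, s.
Qed.

Lemma sorted_add_pair E x y s : sorted (add_pair E x y) s -> (x \notin s) || (y \notin s) ->
  sorted E s.
Proof.
move=> ss nxy; apply: contraT => /not_sorted_split[s1 [b [c [s2 [eqs nE]]]]].
move: ss; rewrite eqs => /cat_sorted2[_] /= /andP[]; rewrite /add_pair (negPf nE) /=.
case/andP=> _ /orP[] /andP[/eqP eb /eqP ec] _; move: nxy; rewrite eqs !mem_cat !inE eb ec;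
  by rewrite !eqxx !orbT.
Qed.

Lemma config_of_long_path E H l x y : symmetric E -> pathfree E H l ->
    x != y -> ~~ E x y -> long_path (add_pair E x y) H l ->
  exists p r, config E H l x p y r.
Proof.
move=> symE free xy nE /existsP[[s /= /eqP sz] /and3P[ss us /allP sH]].
have : ~~ sorted E s.
  by apply/negP=> sE; have := free s sE us sH; rewrite sz ltnn.
case/not_sorted_split=> s1 [b [c [s2 [eqs nbc]]]].
rewrite eqs in ss us sH sz.
have ss1 : sorted (add_pair E x y) (rcons s1 b).
  by move: ss; rewrite -cat_rcons => /cat_sorted2[].
have ss2 : sorted (add_pair E x y) (c :: s2).
  by move: ss; rewrite -cat_rcons => /cat_sorted2[].
have [us1 us2 un12] : [/\ uniq (rcons s1 b), uniq (c :: s2)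
    & ~~ has (mem (rcons s1 b)) (c :: s2)].
  by move: us; rewrite -cat_rcons cat_uniq => /and3P[].
have [b1 c2] : b \notin c :: s2 /\ c \notin rcons s1 b.
  move/hasPn: un12 => un12; split; last by apply: un12; rewrite inE eqxx.
  by apply/negP => /un12; rewrite /= mem_rcons inE eqxx.
have : add_pair E x y b c by move: ss => /cat_sorted2[_ /= /andP[]].
rewrite /add_pair (negPf nbc) xy /= => ebc.
have s1E : sorted E (rcons s1 b).
  apply: sorted_add_pair ss1 _.
  by case/orP: ebc => /andP[/eqP eb /eqP ec]; rewrite -ec c2 ?orbT.
have s2E : sorted E (c :: s2).
  apply: sorted_add_pair ss2 _.
  by case/orP: ebc => /andP[/eqP eb /eqP ec]; rewrite -eb b1 ?orbT.
have s1E' : path E b (rev s1).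
  have : sorted E (rev (rev s1) ++ b :: [::]) by rewrite revK cats1.
  by rewrite sorted_rev_cat // andbT.
have pm : perm_eq (b :: rev s1 ++ c :: s2) (s1 ++ b :: c :: s2).
  by apply/permP => P; rewrite /= !count_cat count_rev /=; clear; lia.
have cfg : ~~ E b c -> config E H l b (rev s1) c s2.
  split=> //.
  - by rewrite (perm_uniq pm).
  - by move=> t; rewrite (perm_mem pm); apply: sH.
  - by rewrite (perm_size pm) sz.
case/orP: ebc nbc => /andP[/eqP eb /eqP ec]; rewrite eb ec in cfg *.
  by move=> /cfg ?; exists (rev s1), s2.
by move=> /cfg /(config_sym symE) ?; exists s2, (rev s1).
Qed.

Definition min_degree_gt j E (C : {set T}) := [forall z in C, j < #|[set t in C | E z t]|].

Definition core j E H : {set T} := \bigcup_(C : {set T} | (C \subset H) && min_degree_gt j E C) C.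

Lemma core_sub j E H : core j E H \subset H.
Proof. by apply/bigcupsP => C /andP[]. Qed.

Lemma sub_core j E H C : C \subset H -> min_degree_gt j E C -> C \subset core j E H.
Proof. by move=> sCH gC; apply: (bigcup_max C); rewrite ?sCH. Qed.

Lemma nbrs_mono E C C' z : C \subset C' ->
  #|[set t in C | E z t]| <= #|[set t in C' | E z t]|.
Proof.
move=> /subsetP sC; apply/subset_leq_card/subsetP => t.
by rewrite !inE => /andP[/sC-> ->].
Qed.

Lemma min_degree_core j E H : min_degree_gt j E (core j E H).
Proof.
apply/forall_inP => z /bigcupP[C /andP[sCH gC] zC].
apply: leq_trans (nbrs_mono E z (sub_core sCH gC)).
by move/forall_inP: gC; apply.
Qed.

Lemma cliques_core E H u v s j r W : symmetric E -> irreflexive E ->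
    core j E H \subset W -> W \subset H -> u \notin H -> v \notin H ->
    #|core j E H| + 2 <= r -> r <= #|W| + 2 ->
  #|cliques E (W :|: [set u; v]) s|
    <= 'C(r, s) + (#|W| + 2 - r) * 'C(j + 2, s.-1).
Proof.
move=> symE irrE; have [m] := ubnP #|W|; elim: m W => // m IHm W ltm sCW sWH uH vH leCr lerW.
have cardWuv : #|W :|: [set u; v]| <= #|W| + 2.
  by apply: leq_trans (leq_card_setU _ _) _; rewrite leq_add2l cards2; case: eqP.
have [le | lt] := leqP (#|W| + 2) r.
  apply: leq_trans (cliques_le _ _ _) _; apply: leq_trans (leq_addr _ _).
  by apply: bin_le; apply: leq_trans cardWuv le.
have /subsetPn[x0 x0W x0C] : ~~ (W \subset core j E H).
  by apply/negP => /subset_leq_card; move: lt leCr; clear; lia.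
have /forall_inPn[x xW] : ~~ min_degree_gt j E W.
  by apply: contra x0C => gW; apply: (subsetP (sub_core sWH gW)).
rewrite -leqNgt => degx.
have xC : x \notin core j E H.
  apply/negP => xC; have /forall_inP/(_ x xC) := min_degree_core j E H.
  by rewrite ltnNge (leq_trans (nbrs_mono E x sCW)).
have xH := subsetP sWH x xW.
apply: leq_trans (cliques_del E _ x s) _.
have -> : (W :|: [set u; v]) :\ x = (W :\ x) :|: [set u; v].
  have [xu xv] : x != u /\ x != v by split; apply: contraTneq xH => ->.
  apply/setP => t; rewrite !inE; case: eqVneq => //= ->.
  by rewrite (negPf xu) (negPf xv).
have cW := cardsD1 x W; rewrite xW in cW.
have := IHm (W :\ x); rewrite subsetD1 sCW xC (subset_trans (subsetDl _ _)) //.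
move=> IH; have {}IH : #|cliques E (W :\ x :|: [set u; v]) s| <=
    'C(r, s) + (#|W :\ x| + 2 - r) * 'C(j + 2, s.-1).
  by apply: IH => //; move: ltm lt; rewrite cW; clear; lia.
have leN : 'C(#|[set t in W :|: [set u; v] | E x t]|, s.-1) <= 'C(j + 2, s.-1).
  apply: bin_le; apply: leq_trans (_ : #|[set t in W | E x t] :|: [set u; v]| <= _).
    apply/subset_leq_card/subsetP => t; rewrite !inE.
    by case/andP=> /orP[->|->] ->; rewrite ?orbT.
  apply: leq_trans (leq_card_setU _ _) _; rewrite leq_add //.
  by rewrite cards2; case: eqP.
apply: leq_trans (leq_add IH leN) _.
have -> : #|W| + 2 - r = (#|W :\ x| + 2 - r).+1 by move: lt; rewrite cW; clear; lia.
by rewrite mulSn; clear; lia.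
Qed.

Lemma kopylov_edge_maximal E V u v s k :
    symmetric E -> irreflexive E -> u \in V -> v \in V -> u != v ->
    2 < s -> s <= k -> k < #|V| ->
    let H := V :\: [set u; v] in
    connected_on E H -> pathfree E H (k - 2) ->
    {in H &, forall x y, x != y -> ~~ E x y -> long_path (add_pair E x y) H (k - 2)} ->
  #|cliques E V s| < extremal s k #|V|.
Proof.
move=> symE irrE uV vV uv s_gt2 lesk ltkV H cH free emax.
have uvV : [set u; v] \subset V by rewrite subUset !sub1set uV.
have uH : u \notin H by rewrite !inE eqxx.
have vH : v \notin H by rewrite !inE eqxx orbT.
have cardH : #|V| = #|H| + 2.
  by rewrite -(cardsID [set u; v] V) (setIidPr uvV) cards2 uv addnC.
have HuvV : H :|: [set u; v] = V by rewrite -[RHS](setID V [set u; v]) (setIidPr uvV) setUC.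
have notcliqH : ~~ clique E H.
  apply/negP => cqH; have := free (enum H); rewrite enum_uniq -cardE => h.
  have : #|H| <= k - 2.
    apply: h => //; last by move=> t; rewrite mem_enum.
    case e : (enum H) => [//|a p]; apply: clique_path cqH _ _; rewrite -e ?enum_uniq //.
    by move=> t; rewrite mem_enum.
  by move: ltkV s_gt2 lesk; rewrite cardH; clear; lia.
have core0 : H \subset core 0 E H.
  apply: sub_core => //; apply/forall_inP => z zH.
  have [||a [b [/set1P -> bH Ezb]]] := cH [set z].
  - by apply/set0Pn; exists z; rewrite inE.
  - rewrite properE sub1set zH; apply/negP => /subset_leq_card; rewrite cards1.
    by move: ltkV s_gt2 lesk; rewrite cardH; clear; lia.
  rewrite card_gt0; apply/set0Pn; exists b; rewrite inE Ezb andbT.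
  by case/setDP: bH.
have ex_core : exists j, clique E (core j E H).
  exists #|H|; apply/cliqueP => x y xC.
  have /forall_inP/(_ x xC) := min_degree_core #|H| E H.
  rewrite ltnNge => /negP[]; apply/subset_leq_card/subsetP => t.
  by rewrite inE => /andP[/(subsetP (core_sub _ _ _))].
have emax' z t : z \in H -> t \in H -> z != t -> ~~ E z t ->
    exists p r, config E H (k - 2) z p t r.
  by move=> zH tH zt nE; apply: config_of_long_path => //; apply: emax.
case: (ex_minnP ex_core) => -[|b] cqb minb.
  by case/negP: notcliqH; apply: cliqueS core0 cqb.
have : ~~ clique E (core b E H) by apply/negP => /minb; rewrite ltnn.
have degree j z : z \in core j E H -> j.+1 <= #|[set t in core j E H | E z t]|.
  by have /forall_inP := min_degree_core j E H; apply.
have inH j z : z \in core j E H -> z \in H by apply/subsetP/core_sub.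
move=> notcq; have [x [y [xC yC xy nE]]] : exists x y, [/\ x \in core b E H,
    y \in core b E H, x != y & ~~ E x y].
  case/forall_inPn: notcq => x xC /forall_inPn[y yC]; rewrite negb_imply => /andP[xy nE].
  by exists x, y.
have le2b : b.+1 + b.+1 < k - 2.
  exact: (core_pair symE irrE cH free (inH _) (inH _) emax' (degree b) (degree b) xC yC xy nE).
have cardC : #|core b.+1 E H| + 2 <= k - b.+1.
  have [C0 | C_gt0] := posnP #|core b.+1 E H|; first by rewrite C0; move: le2b; clear; lia.
  have : 0 < #|core b.+1 E H| by [].
  rewrite card_gt0 => /set0Pn[z zC].
  have ltC : b.+1 < #|core b.+1 E H|.
    apply: leq_trans (degree _ _ zC) _; apply/subset_leq_card/subsetP => t.
    by rewrite inE => /andP[].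
  have /subsetPn[y' y'C y'C'] : ~~ (core b E H \subset core b.+1 E H).
    by apply: contra notcq => /cliqueS; apply.
  have /exists_inP[x' x'C nE'] : [exists x' in core b.+1 E H, ~~ E x' y'].
    apply: contraT => /exists_inPn alladj; case/negP: y'C'.
    have gC : min_degree_gt b.+1 E (y' |: core b.+1 E H).
      apply/forall_inP => t; rewrite inE => /orP[/set1P->|tC].
        apply: leq_trans ltC _; apply/subset_leq_card/subsetP => w wC.
        by have := alladj w wC; rewrite negbK !inE wC orbT symE => ->.
      by apply: leq_trans (degree _ _ tC) _; apply/nbrs_mono/subsetUr.
    have sH : y' |: core b.+1 E H \subset H.
      by rewrite subUset sub1set (inH _ _ y'C) core_sub.
    by apply: (subsetP (sub_core sH gC)); rewrite !inE eqxx.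
  have x'y' : x' != y' by apply: contraNneq y'C' => <-.
  have degC : {in core b.+1 E H, forall z, #|core b.+1 E H|.-1 <=
      #|[set t in core b.+1 E H | E z t]|}.
    move=> t tC; rewrite (cardsD1 t) tC /=; apply/subset_leq_card/subsetP => w.
    rewrite !inE => /andP[wt wC]; rewrite wC; move/cliqueP: cqb; apply=> //.
    by rewrite eq_sym.
  have := core_pair symE irrE cH free (inH _) (inH _) emax' degC (degree b) x'C y'C x'y' nE'.
  by move: C_gt0; clear; lia.
have rE : k - b.+3 + 2 = k - b.+1 by move: le2b; clear; lia.
have ltg : 'C(k - b.+1, s) + (#|V| - (k - b.+1)) * 'C(b.+3, s.-1) < extremal s k #|V|.
  by rewrite -rE; apply: kopylov_lt_extremal => //; move: le2b; clear; lia.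
apply: leq_ltn_trans ltg.
have := @cliques_core E H u v s b.+1 (k - b.+1) H symE irrE (core_sub _ _ _) (subxx _) uH vH cardC.
rewrite HuvV -cardH addn2; apply.
by move: ltkV; rewrite cardH; clear; lia.
Qed.

Lemma kopylov_bound E V u v s k :
    symmetric E -> irreflexive E -> u \in V -> v \in V -> u != v ->
    2 < s -> s <= k -> k < #|V| ->
    connected_on E (V :\: [set u; v]) -> pathfree E (V :\: [set u; v]) (k - 2) ->
  #|cliques E V s| < extremal s k #|V|.
Proof.
move=> symE irrE uV vV uv s_gt2 lesk ltkV; set H := V :\: [set u; v].
have [m] := ubnP #|[set p : T * T | ~~ E p.1 p.2]|.
elim: m E symE irrE => // m IHm E symE irrE ltm cH free.
have [/existsP[x /existsP[y /and5P[xH yH xy nE nolong]]]|none] :=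
   boolP [exists x, [exists y, [&& x \in H, y \in H, x != y, ~~ E x y &
     ~~ long_path (add_pair E x y) H (k - 2)]]]; last first.
  apply: kopylov_edge_maximal cH free _ => // x y xH yH xy nE.
  move/existsPn/(_ x)/existsPn/(_ y): none.
  by rewrite xH yH xy nE /= negbK.
have sub a b : E a b -> add_pair E x y a b by rewrite /add_pair => ->.
apply: leq_ltn_trans (cliques_mono (E' := add_pair E x y) s _) _; first by move=> a b _ _; apply: sub.
apply: IHm.
- exact: add_pair_sym.
- exact: add_pair_irr.
- rewrite -ltnS; apply: leq_trans ltm; rewrite ltnS; apply: proper_card; apply/properP; split.
    by apply/subsetP => p; rewrite !inE; apply/contra/sub.
  by exists (x, y); rewrite !inE //= /add_pair xy !eqxx orbT.
- move=> S S0 sS; have [a [b [aS bS Eab]]] := cH S S0 sS.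
  by exists a, b; split=> //; apply: sub.
- exact/pathfreeP.
Qed.

End Graphs.

(** * The Kelmans shift *)

Section Shift.

Variables (T : finType) (E : rel T) (u w : T).
Hypotheses (symE : symmetric E) (irrE : irreflexive E) (uw : E u w).
Implicit Types (D S Q V : {set T}) (a b c x y z v : T).

Definition shift : rel T := fun a b =>
  if a == u then (b != u) && (E u b || E w b)
  else if a == w then E w b && (E u b || (b == u))
  else if b == u then E u a || E w a
  else if b == w then E w a && E u a
  else E a b.

Let neq_wu : w != u.
Proof. by apply: contraTneq uw => ->; rewrite irrE. Qed.

Let neq_uw : u != w. Proof. by rewrite eq_sym. Qed.

Lemma shift_sym : symmetric shift.
Proof.
move=> a b; rewrite /shift.
have [->|au] := eqVneq a u; have [bu|bu] := eqVneq b u; rewrite ?bu ?eqxx //=.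
- have [->|bw] := eqVneq b w; last by [].
  by rewrite (symE w u) uw ?orbT ?andbT.
- have [->|aw] := eqVneq a w; last by [].
  by rewrite (symE w u) uw ?orbT ?andbT.
by have [ea|_] := eqVneq a w; have [eb|_] := eqVneq b w;
  rewrite ?ea ?eb ?orbF // symE.
Qed.

Lemma shift_irr : irreflexive shift.
Proof.
move=> a; rewrite /shift; case: eqVneq => //= _; case: eqVneq => [->|_]; by rewrite irrE.
Qed.

Lemma shift_other a b : a != u -> a != w -> b != u -> b != w -> shift a b = E a b.
Proof. by rewrite /shift => /negPf-> /negPf-> /negPf-> /negPf->. Qed.

Lemma shift_u b : b != u -> shift u b = E u b || E w b.
Proof. by rewrite /shift eqxx => ->. Qed.

Lemma shift_w b : b != u -> shift w b = E w b && E u b.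
Proof. by rewrite /shift (negPf neq_wu) eqxx => /negPf->; rewrite orbF. Qed.

Lemma shift_uw : shift u w.
Proof. by rewrite shift_u // uw. Qed.

Lemma shift_sub a b : a != w -> b != w -> E a b -> shift a b.
Proof.
move=> aw bw Eab; rewrite /shift (negPf aw) (negPf bw).
case: eqVneq Eab => [-> Eub|au]; first by rewrite Eub andbT; apply: contraTneq Eub => ->; rewrite irrE.
by case: eqVneq => [->|_] //; rewrite symE => ->.
Qed.

Lemma shift_path a p : u \notin a :: p -> w \notin a :: p -> path shift a p -> path E a p.
Proof.
move=> up wp; apply: (@sub_in_path _ (mem (a :: p))); last exact/allP.
move=> x y xp yp; rewrite shift_other //; by [apply: contraNneq up => <-| apply: contraNneq wp => <-].
Qed.

Lemma shift_path_w p : u \notin p -> w \notin p -> path shift w p -> path E w p.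
Proof.
case: p => //= b q un wn /andP[wb bq]; rewrite shift_path // andbT.
move: wb; rewrite shift_w; first by case/andP.
by apply: contraNneq un => ->; rewrite inE eqxx.
Qed.

Lemma shift_bounded V v k : w \in V -> v != w ->
  bounded E V u v k -> bounded shift V u v k.
Proof.
move=> wV vw bd p pp lastp un sV; have [wp|wp] := boolP (w \in p); last first.
  case: p pp lastp un sV wp => [|z q] /=.
    by move=> _ eqv _ _ _; apply: (bd [::]).
  move=> /andP[uz zq] lastp /andP[unin un] sV wp.
  have zqE : path E z q by apply: shift_path.
  have zu : z != u by apply: contraNneq unin => ->; rewrite inE eqxx.
  move: uz; rewrite shift_u // => /orP[uz|wz].
    by apply: (bd (z :: q)); rewrite //= ?uz ?zqE ?unin.
  apply: ltnW; apply: (bd (w :: z :: q)); rewrite //= ?uw ?wz ?zqE //.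
    by rewrite inE negb_or neq_uw unin wp.
  by move=> t; rewrite inE => /predU1P[->|/sV].
case/splitPr: wp pp lastp un sV => p1 p2.
rewrite cat_path last_cat => /andP[pp1 /andP[aw pw2]] lastp un sV.
have [un1 un2] : u \notin p1 /\ u \notin p2.
  by move: un; rewrite /= mem_cat inE !negb_or -!andbA => /and4P[? _ ?].
have [wn1 wn2] : w \notin p1 /\ w \notin p2.
  move: un => /= /andP[_]; rewrite cat_uniq /= negb_or -!andbA.
  by case/and5P.
have w2E := shift_path_w un2 wn2 pw2.
case: p1 pp1 aw lastp un sV un1 wn1 => [|z q] /=.
  move=> _ _ lastp un sV _ _; apply: (bd (w :: p2)) => //=.
  by rewrite uw.
move=> /andP[uz zq] aw lastp un sV un1 wn1.
have zqE : path E z q by apply: shift_path.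
have zu : z != u by apply: contraNneq un1 => ->; rewrite inE eqxx.
have lastu : last z q != u by apply: contraNneq un1 => <-; apply: mem_last.
move: aw; rewrite shift_sym shift_w // => /andP[wa ua].
move: uz; rewrite shift_u // => /orP[uz|wz].
  by apply: (bd (z :: q ++ w :: p2)); rewrite //= ?cat_path ?last_cat //= uz zqE symE wa.
have pm : perm_eq (rev (z :: q) ++ w :: p2) (z :: q ++ w :: p2).
  by rewrite -cat_cons perm_cat2r perm_rev.
have := bd (rev (z :: q) ++ w :: p2); rewrite (perm_size pm) /=; apply.
- by rewrite cat_path path_rev // last_rev ua zqE /= symE wz.
- by rewrite last_cat.
- have pm' : perm_eq (u :: rev (z :: q) ++ w :: p2) (u :: z :: q ++ w :: p2).
    by rewrite perm_cons.
  by have : uniq (u :: z :: q ++ w :: p2) := un; rewrite -(perm_uniq pm').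
- by move=> t; rewrite (perm_mem pm); apply: sV.
Qed.

Lemma shift_linked_aux V v x S : linked E V u v ->
    (forall D, D != set0 -> D \subset V :\: [set u; v; w] ->
       exists a b, [/\ a \in D, b \in V :\: D, b \notin [set u; w] & E a b]) ->
    w \in V -> u \in V -> S != set0 -> S \subset V :\: [set u; v; x] -> w \notin S ->
  exists a b, [/\ a \in S, b \in V :\: S, b != x, b != w & shift a b].
Proof.
move=> lk noncut wV uV S0 sS wS.
have uS : u \notin S by apply/negP => /(subsetP sS); rewrite !inE eqxx.
have [eux|ux] := eqVneq u x.
  have [|a [b [aS bS]]] := noncut S S0.
    apply/subsetP => t tS; have := subsetP sS t tS; rewrite !inE !negb_or.
    case/andP=> /andP[-> _] ->; rewrite andbT /=.
    by apply: contraNneq wS => <-.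
  rewrite !inE negb_or => /andP[bu bw] Eab.
  exists a, b; rewrite -eux bu bw; split=> //.
  by apply: shift_sub Eab => //; apply: contraNneq wS => <-.
have [a [b [aS bS bx Eab]]] := lk x S S0 sS.
have aw : a != w by apply: contraNneq wS => <-.
have au : a != u by apply: contraNneq uS => <-.
have [ebw|bw] := eqVneq b w; last by exists a, b; split=> //; apply: shift_sub.
exists a, u; split=> //; first by rewrite inE uS uV.
by rewrite shift_sym shift_u // symE (symE w) -ebw Eab orbT.
Qed.

Lemma shift_linked V v c : linked E V u v ->
    (forall D, D != set0 -> D \subset V :\: [set u; v; w] ->
       exists a b, [/\ a \in D, b \in V :\: D, b \notin [set u; w] & E a b]) ->
    w \in V -> u \in V -> c \in V -> E u c -> E w c ->
  linked shift V u v.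
Proof.
move=> lk noncut wV uV cV uc wc x S S0 sS.
have [wS|wS] := boolP (w \in S); last first.
  have [a [b [aS bS bx _ ab]]] := shift_linked_aux lk noncut wV uV S0 sS wS.
  by exists a, b.
have uS : u \notin S by apply/negP => /(subsetP sS); rewrite !inE eqxx.
have [eux|ux] := eqVneq u x; last first.
  by exists w, u; split=> //; rewrite ?inE ?uS // shift_sym shift_uw.
have cw : c != w by apply: contraTneq wc => ->; rewrite irrE.
have cu : c != u by apply: contraTneq uc => ->; rewrite irrE.
have [cS|cS] := boolP (c \in S); last first.
  by exists w, c; rewrite -eux; split=> //; rewrite ?inE ?cS // shift_w // wc uc.
have [||a [b [aS bS ]]] := noncut (S :\ w).
- by apply/set0Pn; exists c; rewrite !inE cw.
- apply/subsetP => t; rewrite !inE => /andP[tw tS]; have := subsetP sS t tS.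
  by rewrite !inE !negb_or tw => /andP[/andP[-> _] ->].
rewrite !inE negb_or => /andP[bu bw] Eab; exists a, b; rewrite -eux bu; split=> //.
- by case/setD1P: aS.
- by move: bS; rewrite !inE bw.
- by apply: shift_sub Eab => //; case/setD1P: aS.
Qed.

Lemma shift_linked_del V v : linked E V u v ->
    (forall D, D != set0 -> D \subset V :\: [set u; v; w] ->
       exists a b, [/\ a \in D, b \in V :\: D, b \notin [set u; w] & E a b]) ->
    w \in V -> u \in V ->
  linked shift (V :\ w) u v.
Proof.
move=> lk noncut wV uV x S S0 sS.
have [||a [b [aS bS bx bw ab]]] := shift_linked_aux (x := x) lk noncut wV uV S0.
- by apply: subset_trans sS _; apply: setSD; apply: subsetDl.
- by apply/negP => /(subsetP sS); rewrite !inE eqxx andbF.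
by exists a, b; split=> //; move: bS; rewrite !inE bw.
Qed.

Lemma shift_clique Q : clique E Q ->
  (w \in Q -> {in Q, forall b, b != w -> b != u -> E u b}) -> clique shift Q.
Proof.
move=> /cliqueP cQ wQ; apply/cliqueP => a b aQ bQ ab; have Eab := cQ a b aQ bQ ab.
wlog aw : a b aQ bQ ab Eab / b != w.
  move=> IH; have [ebw|bw] := eqVneq b w; last exact: IH.
  rewrite shift_sym; apply: IH => //; first by rewrite eq_sym.
    by rewrite symE.
  by rewrite -ebw.
have [eaw|aw'] := eqVneq a w; last exact: shift_sub.
rewrite eaw in aQ Eab *; have [->|bu] := eqVneq b u; first by rewrite shift_sym shift_uw.
by rewrite shift_w // Eab; apply: wQ.
Qed.

Lemma shift_cliques V s : u \in V -> #|cliques E V s| <= #|cliques shift V s|.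
Proof.
move=> uV; rewrite -(cardsID (cliques shift V s)) -[X in _ <= X](cardsID (cliques E V s)).
rewrite setIC leq_add2l; pose f S := u |: (S :\ w).
have inD S : S \in cliques E V s :\: cliques shift V s ->
    [/\ w \in S, u \notin S, S \subset V /\ #|S| = s, clique E S & ~~ clique shift S].
  rewrite !inE => /andP[nS /and3P[sV /eqP cS cE]]; rewrite sV cS cE eqxx /= in nS *.
  have wS : w \in S by apply: contraR nS => wS; apply: shift_clique => //; rewrite (negPf wS).
  split=> //; apply: contra nS => uS; apply: shift_clique => // _ b bS bw bu.
  by move/cliqueP: cE; apply=> //; rewrite eq_sym.
rewrite -(card_in_imset (f := f)); last first.
  move=> S S' /inD[wS uS _ _ _] /inD[wS' uS' _ _ _] eqf.
  rewrite -(setD1K wS) -(setD1K wS'); congr (_ |: _).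
  have uD (A : {set T}) : u \notin A -> u \notin A :\ w by rewrite !inE negb_and => ->; rewrite orbT.
  by rewrite -(setU1K (uD _ uS)) -(setU1K (uD _ uS')) -/(f S) eqf.
apply/subset_leq_card/subsetP => _ /imsetP[S /inD[wS uS [sV cS] cE nS] ->].
have nu : exists2 b, b \in S :\ w & ~~ E u b.
  apply/exists_inP; apply: contraR nS => /exists_inPn allE.
  apply: shift_clique => // _ b bS bw _; have := allE b; rewrite !inE bw bS negbK.
  exact.
have cf : clique shift (f S).
  apply/cliqueP => a b; rewrite !in_setU1 !in_setD1.
  have pair x y : x \in S -> y \in S -> x != w -> y != w -> x != y -> shift x y.
    by move=> xS yS xw yw xy; apply: shift_sub => //; move/cliqueP: cE; apply.
  have upair b' : b' != w -> b' \in S -> shift u b'.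
    move=> bw bS; rewrite shift_u; last by apply: contraNneq uS => <-.
    by apply/orP; right; move/cliqueP: cE; apply=> //; rewrite eq_sym.
  case/predU1P=> [->|/andP[aw aS]]; case/predU1P=> [->|/andP[bw bS]].
  - by rewrite eqxx.
  - by move=> _; apply: upair.
  - by move=> _; rewrite shift_sym; apply: upair.
  - exact: pair.
rewrite !inE cf andbT subUset sub1set uV (subset_trans (subsetDl _ _)) //=.
rewrite cardsU1 !inE (negPf uS) andbF /= add1n.
have := cardsD1 w S; rewrite wS add1n cS => <-; rewrite eqxx /= andbT.
case: nu => b bS nE; apply: contra nE => /cliqueP; apply; rewrite ?in_setU1 ?eqxx ?bS ?orbT //.
by apply: contraNneq uS => ->; case/setD1P: bS.
Qed.

(* In general the shift may disconnect V \ {u, v}, so strictness is recovered by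
   showing that a k-clique of the shifted graph yields a u-v path of [E] on more than
   k vertices. *)
Lemma shift_no_clique V v k Q : rooted E V u v k -> connected_on E (V :\: [set u; v]) ->
    2 < k -> k < #|V| -> w \in V -> w != v -> Q \subset V -> u \in Q -> v \in Q ->
  clique shift Q -> #|Q| != k.
Proof.
move=> G cH k_gt2 ltkV wV wv sQV uQ vQ cQ; have uv := rooted_neq G.
have [wQ|wQ] := boolP (w \in Q).
  have adj b : b \in Q -> b != u -> b != w -> E u b && E w b.
    move=> bQ bu bw; rewrite andbC -shift_w //.
    by move/cliqueP: cQ; apply=> //; rewrite eq_sym.
  apply: (no_clique G cH) => //; apply/cliqueP => a b aQ bQ.
  have [->|au] := eqVneq a u; have [->|bu] := eqVneq b u; rewrite ?eqxx //.
  - have [->|bw _] := eqVneq b w; first by rewrite uw.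
    by case/andP: (adj b bQ bu bw).
  - have [->|aw _] := eqVneq a w; first by rewrite symE uw.
    by rewrite symE; case/andP: (adj a aQ au aw).
  have [->|aw] := eqVneq a w; have [->|bw] := eqVneq b w; rewrite ?eqxx //.
  - by case/andP: (adj b bQ bu bw).
  - by rewrite symE; case/andP: (adj a aQ au aw).
  by move/cliqueP: cQ => cQ ab; rewrite -shift_other //; apply: cQ.
have EQ : {in Q &, forall a b, a != u -> b != u -> a != b -> E a b}.
  move=> a b aQ bQ au bu ab; rewrite -shift_other //; first by move/cliqueP: cQ; apply.
    by apply: contraNneq wQ => <-.
  by apply: contraNneq wQ => <-.
have [/exists_inP[z zQ wz]|/exists_inPn none] := boolP [exists z in Q :\: [set u; v], E w z].
  move: zQ; rewrite !inE negb_or => /andP[/andP[zu zv] zQ].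
  apply/negP => /eqP cardQ; pose rest := enum (Q :\: [set u; v; z]).
  have restP t : t \in rest = [&& t != u, t != v, t != z & t \in Q].
    by rewrite mem_enum !inE !negb_or -!andbA.
  have szr : k <= (size rest).+3.
    rewrite -cardQ -cardE -(cardsID [set u; v; z] Q) addnC -addn3 leq_add2l.
    apply: leq_trans (subset_leq_card (subsetIr _ _)) _.
    by rewrite setUC cardsU1 cards2; case: (z \notin _); case: (u != v).
  suff: size (w :: z :: rcons rest v) < k by rewrite /= size_rcons ltnNge szr.
  have zrv : path E z (rcons rest v).
    apply: (@clique_path _ _ (Q :\ u)).
    - apply/cliqueP => a b; rewrite !inE => /andP[au aQ] /andP[bu bQ]; exact: EQ.
    - by rewrite /= mem_rcons inE restP eqxx !andbF orbF zv rcons_uniq restP eqxx andbF enum_uniq.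
    - move=> t; rewrite inE mem_rcons inE restP !inE.
      by case/or3P=> [/eqP->|/eqP->|/and4P[-> _ _ ->]] //; rewrite ?zu ?zQ // eq_sym uv.
  apply: (rbounded G); rewrite /= ?last_rcons //; first by rewrite uw wz.
  - rewrite !inE !mem_rcons !inE !restP !eqxx !andbF !(negPf wQ) !andbF !orbF.
    rewrite (negPf neq_uw) eq_sym (negPf zu) (negPf uv) (negPf wv) zv rcons_uniq restP eqxx andbF.
    by rewrite enum_uniq !andbT /= orbF; apply: contraNneq wQ => ->.
  - move=> t; rewrite !inE mem_rcons inE restP => /or4P[/eqP->|/eqP->|/eqP->|/and4P[_ _ _ tQ]] //;
      exact: (subsetP sQV).
apply: (no_clique G cH) => //; apply/cliqueP.
have upair b : b \in Q -> b != u -> E u b.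
  move=> bQ bu; have [->|bv] := eqVneq b v; first exact: ruv G.
  have : shift u b by move/cliqueP: cQ; apply=> //; rewrite eq_sym.
  rewrite shift_u // => /orP[//|wb]; have := none b.
  by rewrite !inE negb_or bu bv bQ wb => /(_ isT).
move=> a b aQ bQ; have [->|au] := eqVneq a u; have [->|bu] := eqVneq b u; rewrite ?eqxx //.
- by move=> _; apply: upair.
- by move=> _; rewrite symE; apply: upair.
exact: EQ.
Qed.

End Shift.

(** * The bound on the number of cliques *)

Section Bound.

Variables (T : finType) (s k : nat).
Hypotheses (s_gt2 : 2 < s) (lesk : s <= k).
Implicit Types (E : rel T) (D S Q V Z : {set T}) (a b c x y z u v w : T).

Let k_gt2 : 2 < k. Proof. exact: leq_trans lesk. Qed.

Lemma bounded_sub E V V' u v k1 k2 : V' \subset V -> k1 <= k2 ->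
  bounded E V u v k1 -> bounded E V' u v k2.
Proof.
move=> /subsetP sV le bd p pp lp up sp; apply: leq_trans le; apply: bd => // t /sp.
exact: sV.
Qed.

Lemma bounded_clique E V Q u w j : bounded E V u w j -> Q \subset V -> u \in Q ->
  w \in Q -> u != w -> clique E Q -> #|Q| <= j.
Proof.
move=> bd /subsetP sQ uQ wQ uw cQ; pose p := rcons (enum (Q :\: [set u; w])) w.
have pP t : t \in p = (t != u) && (t \in Q).
  rewrite mem_rcons inE mem_enum !inE; case: eqVneq => [->|_] /=.
    by rewrite eq_sym uw wQ.
  by rewrite orbF.
have up : uniq (u :: p).
  by rewrite /= pP eqxx rcons_uniq mem_enum !inE eqxx orbT enum_uniq.
have <- : (size p).+1 = #|Q|.
  rewrite size_rcons -cardE -(cardsID [set u; w] Q) (setIidPr _) ?cards2 ?uw //.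
  by rewrite subUset !sub1set uQ.
apply: bd => //; last by move=> t; rewrite pP => /andP[_ /sQ].
  apply: clique_path cQ up _ => t; rewrite inE pP => /orP[/eqP->|/andP[]] //.
by rewrite last_rcons.
Qed.

Lemma rooted_closed E V u v Z : rooted E V u v k -> Z \subset V :\: [set u; v] ->
    (forall a b, a \in Z -> b \in V -> b \notin Z -> b \notin [set u; v] -> ~~ E a b) ->
  rooted E (Z :|: [set u; v]) u v k.
Proof.
move=> [symE irrE uV vV uv lk bd] sZ noE.
have sZV : Z :|: [set u; v] \subset V.
  by rewrite subUset (subset_trans sZ (subsetDl _ _)) subUset !sub1set uV.
split=> //; [by rewrite !inE eqxx orbT|by rewrite !inE eqxx !orbT| |exact: bounded_sub bd].
move=> x S S0 sS; have [|a [b [aS bS bx Eab]]] := lk x S S0.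
  by apply: subset_trans sS (setSD _ sZV).
exists a, b; split=> //; move: bS; rewrite !in_setD => /andP[-> bV] /=.
rewrite in_setU; apply: contraT; rewrite negb_or => /andP[bZ buv].
have aZ : a \in Z.
  by have := subsetP sS a aS; rewrite !inE; case: (a == u); case: (a == v); rewrite ?orbF //= => /andP[].
by have := noE a b aZ bV bZ buv; rewrite Eab.
Qed.

Lemma extremal_split n n1 n2 N N1 N2 : N <= N1 + N2 -> N1 <= extremal s k n1 -> N2 <= extremal s k n2 ->
    2 <= n1 -> 2 <= n2 -> n = n1 + n2 - 2 ->
  N <= extremal s k n /\ (N = extremal s k n -> k <= n ->
    [/\ N1 = extremal s k n1, N2 = extremal s k n2 & (k <= n1) || (k <= n2)]).
Proof.
move=> leN le1 le2 n1_ge2 n2_ge2 ->.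
have sup := extremal_superadd s_gt2 lesk n1_ge2 n2_ge2.
split=> [|eqN lek]; first by move: leN le1 le2 sup; clear; lia.
split; [by move: leN le1 le2 sup eqN; clear; lia|by move: leN le1 le2 sup eqN; clear; lia|].
apply: contraT; rewrite negb_or -!ltnNge => /andP[lt1 lt2].
have := @extremal_superadd_strict s k s_gt2 lesk n1 n2.
rewrite n1_ge2 n2_ge2 lt1 lt2 => /(_ isT isT lek).
by move: leN le1 le2 eqN; clear; lia.
Qed.

Definition count_bound E V u v := #|cliques E V s| <= extremal s k #|V| /\
  (#|cliques E V s| = extremal s k #|V| -> k <= #|V| ->
   exists Q, [/\ Q \subset V, u \in Q, v \in Q, clique E Q & #|Q| = k]).

Lemma count_bound_lt E V u v : #|cliques E V s| < extremal s k #|V| -> count_bound E V u v.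
Proof. by move=> lt; split=> [|eqN]; [apply: ltnW|rewrite eqN ltnn in lt]. Qed.

Lemma rooted_card E V u v : rooted E V u v k -> 2 <= #|V|.
Proof.
move=> G; have := subset_leq_card (_ : [set u; v] \subset V).
by rewrite cards2 (rooted_neq G) subUset !sub1set (ru G) (rv G) => /(_ isT).
Qed.

Lemma count_bound_small E V u v : rooted E V u v k -> #|V| <= k -> count_bound E V u v.
Proof.
move=> G leVk; have V_ge2 := rooted_card G.
rewrite /count_bound extremal_small ?V_ge2 //; split; first exact: cliques_le.
move=> eqN lekV; have eqk : #|V| = k by apply/eqP; rewrite eqn_leq leVk.
exists V; split; rewrite ?(ru G) ?(rv G) //.
by apply: cliques_full eqN; rewrite eqk lesk (leq_trans _ s_gt2).
Qed.

Definition smaller_count_bound V :=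
  forall E' V' u' v', rooted E' V' u' v' k -> #|V'| < #|V| -> count_bound E' V' u' v'.

Lemma card_rooted_set E V u v Z : rooted E V u v k -> Z \subset V :\: [set u; v] ->
  #|Z :|: [set u; v]| = #|Z| + 2.
Proof.
move=> G sZ; rewrite cardsU disjoint_setI0 ?cards0 ?subn0 ?cards2 ?(rooted_neq G) //.
rewrite disjoint_sym disjoints_subset; apply/subsetP => t; rewrite !inE => tuv.
by apply: contraL tuv => /(subsetP sZ); rewrite !inE => /andP[].
Qed.

Lemma count_bound_disconnected E V u v S : rooted E V u v k -> smaller_count_bound V ->
    S != set0 -> S \proper V :\: [set u; v] ->
    (forall a b, a \in S -> b \in V :\: [set u; v] :\: S -> ~~ E a b) ->
  count_bound E V u v.
Proof.
move=> G IH S0 prS noE; have sS := proper_sub prS.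
set H := V :\: [set u; v] in prS noE sS *.
have symE := rsym G.
have sHS : H :\: S \subset H by apply: subsetDl.
have G1 : rooted E (S :|: [set u; v]) u v k.
  apply: rooted_closed G sS _ => a b aS bV bS buv; apply: noE => //.
  by rewrite !in_setD bS buv.
have G2 : rooted E ((H :\: S) :|: [set u; v]) u v k.
  apply: rooted_closed G sHS _ => a b aS bV bS buv.
  rewrite symE; apply: noE aS; apply: contraR bS => bS.
  by rewrite !in_setD bS buv.
have c1 := card_rooted_set G sS; have c2 := card_rooted_set G sHS.
have cH : #|V| = #|H| + 2.
  rewrite -(cardsID [set u; v] V) (setIidPr _) ?cards2 ?(rooted_neq G) 1?addnC //.
  by rewrite subUset !sub1set (ru G) (rv G).
have cS : #|H :\: S| = #|H| - #|S| by rewrite cardsDS.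
have ltS : 0 < #|S| < #|H| by rewrite card_gt0 S0 proper_card.
have lt1 : #|S :|: [set u; v]| < #|V| by rewrite c1 cH ltn_add2r; case/andP: ltS.
have lt2 : #|H :\: S :|: [set u; v]| < #|V|.
  by rewrite c2 cH cS ltn_add2r; move: ltS; clear; lia.
have [le1 eq1] := IH _ _ _ _ G1 lt1; have [le2 eq2] := IH _ _ _ _ G2 lt2.
have leN : #|cliques E V s| <= #|cliques E (S :|: [set u; v]) s| +
    #|cliques E (H :\: S :|: [set u; v]) s|.
  apply: cliques_split.
    apply/subsetP => t tV; rewrite !inE tV andbT; case: (t \in S) => //=.
    by case: (t == u); case: (t == v); rewrite ?orbT.
  move=> x y xV yV; rewrite in_setU negb_or => /andP[xS xuv].
  rewrite in_setU negb_or !in_setD => /andP[yS yuv]; rewrite symE; apply: noE.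
    by move: yS; rewrite yV (negPf yuv) !andbT negbK.
  by rewrite !in_setD xS xuv.
have sz : #|V| = #|S :|: [set u; v]| + #|H :\: S :|: [set u; v]| - 2.
  by rewrite c1 c2 cH cS; move: ltS; clear; lia.
have [] := extremal_split leN le1 le2 _ _ sz; rewrite ?(rooted_card G1) ?(rooted_card G2) //.
move=> leV eqV; split=> // eqN lek; have [e1 e2 /orP[k1|k2]] := eqV eqN lek.
  have [Q [sQ uQ vQ cQ cardQ]] := eq1 e1 k1; exists Q; split=> //.
  apply: subset_trans sQ _; rewrite subUset (subset_trans sS (subsetDl _ _)).
  by rewrite subUset !sub1set (ru G) (rv G).
have [Q [sQ uQ vQ cQ cardQ]] := eq2 e2 k2; exists Q; split=> //.
apply: subset_trans sQ _; rewrite subUset (subset_trans sHS (subsetDl _ _)).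
by rewrite subUset !sub1set (ru G) (rv G).
Qed.

(* The paths of the side cut off by {u, w} are continued by a path from [w] to [v],
   hence that side even satisfies the length bound for [k.-1]. *)
Lemma cliques_lt_cut E V u v w D : rooted E V u v k -> connected_on E (V :\: [set u; v]) ->
    k < #|V| -> smaller_count_bound V -> w \in V -> w != v -> E u w ->
    D != set0 -> D \subset V :\: [set u; v; w] ->
    (forall a b, a \in D -> b \in V -> b \notin D -> b \notin [set u; w] -> ~~ E a b) ->
  #|cliques E V s| < extremal s k #|V|.
Proof.
move=> G cH ltkV IH wV wv uw D0 sD noE.
have [symE irrE uV vV uv lk bd] := G.
have neq_uw : u != w by apply: contraTneq uw => ->; rewrite irrE.
have DP a : a \in D -> [/\ a \in V, a != u, a != v & a != w].
  by move/(subsetP sD); rewrite !inE !negb_or -!andbA => /and4P[].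
have [uD vD wD] : [/\ u \notin D, v \notin D & w \notin D].
  by split; apply/negP => /DP[]; rewrite eqxx.
have sDV : D \subset V by apply/subsetP => a /DP[].
have lkw S : w \in S -> S \subset (V :\: D) :\: [set u; v] ->
    exists a b, [/\ a \in S, b \in V :\: D :\: S, b != u & E a b].
  move=> wS sS; have [||a [b [aS bS bu Eab]]] := lk u (S :|: D).
  - by apply/set0Pn; exists w; rewrite inE wS.
  - rewrite setUAC setUid subUset; apply/andP; split.
      by apply: subset_trans sS _; apply: setSD; apply: subsetDl.
    apply/subsetP => a aD; have [aV au av aw] := DP a aD.
    by rewrite !inE aV (negPf au) (negPf av).
  move: bS aS; rewrite !inE negb_or => /andP[/andP[bS bD] bV] /orP[aS|aD].
    by exists a, b; split=> //; rewrite !inE bS bD.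
  have : b \notin [set u; w] by rewrite !inE negb_or bu; apply: contraNneq bS => ->.
  by move/(noE a b aD bV bD); rewrite Eab.
have G2 : rooted E (V :\: D) u v k.
  split; rewrite ?inE ?uD ?vD //; last exact: bounded_sub (subsetDl _ _) (leqnn k) bd.
  move=> x S S0 sS.
  have uS : u \notin S by apply/negP => /(subsetP sS); rewrite !inE eqxx.
  have sSD : S \subset V :\: D by apply: subset_trans sS (subsetDl _ _).
  have [wS|wS] := boolP (w \in S).
    have [ux|ux] := eqVneq u x; last first.
      by exists w, u; split=> //; rewrite ?inE ?uS ?uD // symE.
    rewrite -ux in sS *; apply: lkw => //.
    by apply: subset_trans sS _; apply: setDS; apply: subsetUl.
  have [|a [b [aS bS bx Eab]]] := lk x S S0.
    by apply: subset_trans sS _; apply: setSD; apply: subsetDl.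
  exists a, b; split=> //; move: bS; rewrite !inE => /andP[-> bV]; rewrite bV /= andbT.
  apply/negP => bD; have aVD := subsetP sSD a aS.
  have := noE b a bD; rewrite symE Eab; move: aVD; rewrite !inE => /andP[-> ->].
  move=> /(_ isT isT); rewrite negb_or => /(_ _)/negP; apply=> //.
  by rewrite !(contraTneq _ aS) // => ->.
have [||q [b [wq uq sq bv]]] := @reach T E (V :\: D :\ u) [set v] w.
- by rewrite !inE wv wD wV eq_sym neq_uw.
- move=> S wS sS; have [|a [b [aS bS bu Eab]]] := lkw S wS.
    by apply: subset_trans sS _; apply/subsetP => t; rewrite !inE negb_or => /and3P[-> -> ->].
  by exists a, b; split=> //; move: bS; rewrite !inE bu.
have {}bv : b = v by move: bv; rewrite !inE => /andP[_ /eqP].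
subst b.
have sV1 : D :|: [set u; w] \subset V by rewrite subUset sDV subUset !sub1set uV.
have bd1 : bounded E (D :|: [set u; w]) u w k.-1.
  move=> p pp lp up sp.
  have inq t : t \in rcons q v -> (t \in V) * (t \in D :|: [set u; w] = false).
    move=> tq; have tw : t != w by apply: contraTneq tq => ->; case/andP: uq.
    move: tq; rewrite mem_rcons in_cons => /predU1P[->|/sq].
      by rewrite vV !inE (negPf vD) -[v == u]eq_sym (negPf (rooted_neq G)) -[v == w]eq_sym (negPf wv).
    by rewrite !inE (negPf tw) => /and4P[_ /negPf-> /negPf-> ->].
  have : size (p ++ rcons q v) < k.
    apply: bd.
    - by rewrite cat_path pp lp.
    - by rewrite last_cat last_rcons.
    - rewrite -cat_cons cat_uniq up andTb; move: (uq); rewrite cons_uniq => /andP[_ uq']; rewrite uq' andbT.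
      apply/hasPn => t /inq[_ tV1]; apply/negP; rewrite inE => /predU1P[tu|/sp].
        by move: tV1; rewrite tu !inE eqxx orbT.
      by rewrite tV1.
    - by move=> t; rewrite mem_cat => /orP[/sp /(subsetP sV1)|/inq[]].
  by rewrite size_cat size_rcons; move: k_gt2; clear; lia.
have G1 : rooted E (D :|: [set u; w]) u w k.
  split=> //; rewrite ?inE ?eqxx ?orbT //; last exact: bounded_sub (subxx _) (leq_pred k) bd1.
  move=> x S S0 sS; have sSD : S \subset D.
    apply: subset_trans sS _; apply/subsetP => t; rewrite !inE !negb_or.
    by case/andP=> /andP[/andP[/negPf-> /negPf->] _]; rewrite !orbF.
  have [|a [b [aS bS bx Eab]]] := lk x S S0.
    apply/subsetP => t tS; have [tV tu tv tw] := DP t (subsetP sSD t tS).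
    have := subsetP sS t tS; rewrite !inE tV (negPf tu) (negPf tv) (negPf tw).
    by rewrite (subsetP sSD t tS).
  exists a, b; split=> //; move: bS; rewrite !in_setD => /andP[-> bV] /=.
  rewrite in_setU; apply: contraT; rewrite negb_or => /andP[bD buw].
  by have := noE a b (subsetP sSD a aS) bV bD buw; rewrite Eab.
have c1 : #|D :|: [set u; w]| = #|D| + 2.
  rewrite cardsU disjoint_setI0 ?cards0 ?subn0 ?cards2 ?neq_uw //.
  rewrite disjoints_subset; apply/subsetP => t /DP[_ tu _ tw].
  by rewrite !inE negb_or tu.
have c2 : #|V :\: D| = #|V| - #|D| by rewrite cardsDS.
have D_gt0 : 0 < #|D| by rewrite card_gt0.
have leD : #|D| + 3 <= #|V|.
  have := subset_leq_card sD; rewrite cardsDS; last by rewrite !subUset !sub1set uV vV.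
  have -> : #|[set u; v; w]| = 3.
    by rewrite setUC cardsU1 cards2 !inE negb_or eq_sym neq_uw wv (rooted_neq G).
  have : #|[set u; v; w]| <= #|V| by apply: subset_leq_card; rewrite !subUset !sub1set uV vV.
  have -> : #|[set u; v; w]| = 3.
    by rewrite setUC cardsU1 cards2 !inE negb_or eq_sym neq_uw wv (rooted_neq G).
  by clear; lia.
have [|le1 eq1] := IH _ _ _ _ G1; first by rewrite c1; move: leD; clear; lia.
have [|le2 eq2] := IH _ _ _ _ G2; first by rewrite c2; move: leD D_gt0; clear; lia.
have leN : #|cliques E V s| <= #|cliques E (D :|: [set u; w]) s| + #|cliques E (V :\: D) s|.
  apply: cliques_split.
    by apply/subsetP => t tV; rewrite !inE tV andbT; case: (t \in D); rewrite ?orbT.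
  move=> x y xV yV; rewrite in_setU negb_or => /andP[xD xuw].
  rewrite !inE yV andbT negbK => yD; rewrite symE.
  exact: noE yD xV xD xuw.
have sz : #|V| = #|D :|: [set u; w]| + #|V :\: D| - 2.
  by rewrite c1 c2; move: leD; clear; lia.
have [] := extremal_split leN le1 le2 _ _ sz; rewrite ?(rooted_card G1) ?(rooted_card G2) //.
move=> leV eqV; rewrite ltn_neqAle leV andbT; apply/eqP => eqN.
have [e1 e2 /orP[k1|k2]] := eqV eqN (ltnW ltkV).
  have [Q [sQ uQ wQ cQ cardQ]] := eq1 e1 k1.
  have := bounded_clique bd1 sQ uQ wQ neq_uw cQ; rewrite cardQ.
  by move: k_gt2; clear; lia.
have [Q [sQ uQ vQ cQ cardQ]] := eq2 e2 k2.
have := no_clique G cH k_gt2 ltkV (subset_trans sQ (subsetDl _ _)) uQ vQ cQ.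
by rewrite cardQ eqxx.
Qed.

Definition rank E V u v :=
  2 * #|V| - (#|[set b in V | E u b]| + #|[set b in V | E v b]|).

Lemma dominating_step E V u v : rooted E V u v k -> connected_on E (V :\: [set u; v]) ->
    k < #|V| -> smaller_count_bound V ->
    (forall E', rooted E' V u v k -> rank E' V u v < rank E V u v -> count_bound E' V u v) ->
  #|cliques E V s| < extremal s k #|V| \/ {in V :\: [set u; v], forall z, E u z}.
Proof.
move=> G cH ltkV IH IHr; have [symE irrE uV vV uv lk bd] := G.
have neq_uv := rooted_neq G.
have [/existsP[w /existsP[D /and5P[wV wv uw D0 /andP[sD /forall_inP noE]]]]|nocut] := boolP
  [exists w, exists D : {set T}, [&& w \in V, w != v, E u w, D != set0 &
    (D \subset V :\: [set u; v; w]) && [forall a in D, forall b in V :\: D,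
       (b \notin [set u; w]) ==> ~~ E a b]]].
  left; apply: cliques_lt_cut wV wv uw D0 sD _ => // a b aD bV bD buw.
  by have /forall_inP/(_ b) := noE a aD; rewrite inE bD bV => /(_ isT)/implyP; apply.
have [/existsP[w /existsP[z /and5P[wV wv uw wz /and3P[zV zu nuz]]]]|noshift] := boolP
  [exists w, exists z, [&& w \in V, w != v, E u w, E w z & [&& z \in V, z != u & ~~ E u z]]];
  [left|right]; last first.
  pose A := [set z in V :\: [set u; v] | E u z].
  have sA : A \subset V :\: [set u; v] by apply/subsetP => t; rewrite inE => /andP[].
  have [eqA z zH|neqA] := eqVneq A (V :\: [set u; v]).
    by move: zH; rewrite -eqA inE => /andP[].
  have [||a [b [aA bA Eab]]] := cH A; last 1 first.
  - move: aA bA; rewrite inE => /andP[aH ua].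
    rewrite in_setD inE negb_and => /andP[+ bH]; rewrite bH /= => nub.
    move/existsPn/(_ a)/existsPn/(_ b): noshift; case/negP.
    move: aH bH; rewrite !inE !negb_or => /andP[/andP[au av] aV] /andP[/andP[bu bv] bV].
    by rewrite aV av ua Eab bV bu nub.
  - have [||a [b [aH bH bv Eab]]] := lk v (V :\: [set u; v]).
    + apply/set0Pn; have /subsetPn[t tV tuv] : ~~ (V \subset [set u; v]).
        apply/negP => /subset_leq_card; rewrite cards2 neq_uv; move: ltkV k_gt2; clear; lia.
      by exists t; rewrite inE tuv.
    + by rewrite -setUA setUid.
    apply/set0Pn; exists a; rewrite inE aH symE; move: bH.
    by rewrite !inE (negPf bv) orbF negb_and negbK => /andP[/orP[/eqP<-//|/negP]].
  - by rewrite properEneq neqA.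
have noncut D : D != set0 -> D \subset V :\: [set u; v; w] ->
    exists a b, [/\ a \in D, b \in V :\: D, b \notin [set u; w] & E a b].
  move=> D0 sD; move/existsPn/(_ w)/existsPn/(_ D): nocut.
  rewrite wV wv uw D0 sD /= => /forall_inPn[a aD /forall_inPn[b bD]].
  by rewrite negb_imply negbK => /andP[bu Eab]; exists a, b.
have [lek symS irrS] : [/\ k <= #|V|, symmetric (shift E u w) & irreflexive (shift E u w)].
  by split; [exact: ltnW|apply: shift_sym|apply: shift_irr].
have wu : w != u by apply: contraTneq uw => ->; rewrite irrE.
have shiftv b : E v b -> shift E u w v b.
  move=> vb; have [ebw|bw] := eqVneq b w; last by apply: shift_sub => //; rewrite eq_sym.
  by rewrite ebw in vb *; rewrite shift_sym // shift_w // 1?symE ?vb // eq_sym.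
apply: leq_ltn_trans (shift_cliques symE irrE uw s uV) _.
have vw : v != w by rewrite eq_sym.
have bdS : bounded (shift E u w) V u v k by apply: shift_bounded.
have noQ Q : Q \subset V -> u \in Q -> v \in Q -> clique (shift E u w) Q -> #|Q| = k -> False.
  move=> sQ uQ vQ cQ /eqP; apply/negP.
  exact: shift_no_clique G cH k_gt2 ltkV wV wv sQ uQ vQ cQ.
have [/exists_inP[c cV /andP[uc wc]]|/exists_inPn nocommon] := boolP [exists c in V, E u c && E w c].
  have G' : rooted (shift E u w) V u v k.
    split=> //; first by rewrite shift_sub // eq_sym.
    exact: shift_linked wV uV cV uc wc.
  have [|le eqN] := IHr _ G'.
    have lt_u : #|[set b in V | E u b]| < #|[set b in V | shift E u w u b]|.
      apply: proper_card; apply/properP; split.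
        apply/subsetP => b; rewrite !inE => /andP[-> ub]; rewrite shift_u ?ub //.
        by apply: contraTneq ub => ->; rewrite irrE.
      by exists z; rewrite !inE zV ?(negPf nuz) // shift_u // wz orbT.
    have le_v : #|[set b in V | E v b]| <= #|[set b in V | shift E u w v b]|.
      by apply/subset_leq_card/subsetP => b; rewrite !inE => /andP[-> /shiftv].
    have leV t E' : #|[set b in V | (E' : rel T) t b]| <= #|V|.
      by apply/subset_leq_card/subsetP => b; rewrite inE => /andP[].
    have := leV u (shift E u w); have := leV v (shift E u w).
    by move: lt_u le_v; rewrite /rank; clear; lia.
  rewrite ltn_neqAle le andbT; apply/eqP => /eqN/(_ lek)[Q [sQ uQ vQ cQ cardQ]].
  exact: noQ cardQ.
have c1 := cardsD1 w V; rewrite wV add1n in c1.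
have G' : rooted (shift E u w) (V :\ w) u v k.
  split; rewrite ?inE ?uV ?vV ?vw ?andbT // 1?eq_sym //.
  - by rewrite shift_sub // eq_sym.
  - exact: shift_linked_del.
  - exact: bounded_sub (subsetDl _ _) (leqnn k) bdS.
have [|le eqN] := IH _ _ _ _ G'; first by rewrite c1.
have leN : #|cliques (shift E u w) V s| <= #|cliques (shift E u w) (V :\ w) s|.
  apply: leq_trans (cliques_del _ _ w _) _; rewrite -[X in _ <= X]addn0 leq_add2l.
  rewrite leqn0 bin_small //; apply: leq_ltn_trans (_ : 1 < s.-1); last first.
    by move: s_gt2; clear; lia.
  rewrite -(cards1 u); apply/subset_leq_card/subsetP => b; rewrite !inE => /andP[bV].
  apply: contraTT => bu; rewrite shift_w // andbC; exact: nocommon.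
have mono : extremal s k #|V :\ w| <= extremal s k #|V|.
  by rewrite c1; apply: extremal_mono => //; apply: rooted_card G'.
rewrite ltn_neqAle (leq_trans leN (leq_trans le mono)) andbT; apply/eqP => eqV.
have [||Q [sQ uQ vQ cQ cardQ]] := eqN.
- by apply/eqP; rewrite eqn_leq le (leq_trans mono) // -eqV.
- by move: ltkV; rewrite c1.
by apply: noQ cQ cardQ => //; apply: subset_trans sQ (subsetDl _ _).
Qed.

Lemma rank_sym E V u v : rank E V u v = rank E V v u.
Proof. by rewrite /rank addnC. Qed.

Definition connected_onb E (H : {set T}) := [forall S : {set T}, (S != set0) && (S \proper H) ==>
  [exists a in S, [exists b in H :\: S, E a b]]].

Lemma connected_onP E (H : {set T}) : reflect (connected_on E H) (connected_onb E H).
Proof.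
apply: (iffP forallP) => [h S S0 sS|cH S].
  have := h S; rewrite S0 sS => /exists_inP[a aS /exists_inP[b bS Eab]].
  by exists a, b.
apply/implyP => /andP[S0 sS]; have [a [b [aS bS Eab]]] := cH S S0 sS.
by apply/exists_inP; exists a => //; apply/exists_inP; exists b.
Qed.

Lemma pathfree_dominated E V u v : rooted E V u v k ->
    {in V :\: [set u; v], forall z, E u z} -> {in V :\: [set u; v], forall z, E v z} ->
  pathfree E (V :\: [set u; v]) (k - 2).
Proof.
move=> G domu domv [|a p] //= pp up sp.
have [symE irrE uV vV uv lk bd] := G.
have inH t : t \in a :: p -> [/\ t \in V, t != u & t != v].
  by move/sp; rewrite !inE negb_or => /andP[/andP[]].
have h : size (rcons (a :: p) v) < k.
  apply: bd.
  - rewrite rcons_path /= pp domu ?sp ?inE ?eqxx //= symE domv //.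
    by apply: sp; apply: mem_last.
  - by rewrite last_rcons.
  - rewrite cons_uniq rcons_uniq mem_rcons inE negb_or (rooted_neq G) -andbA.
    rewrite (cons_uniq a p) up andbT.
    by apply/and3P; split=> //; apply/negP => /inH[]; rewrite eqxx.
  - by move=> t; rewrite mem_rcons inE => /predU1P[->|/inH[]].
by move: h; rewrite size_rcons /=; clear; lia.
Qed.

Lemma cliques_lt_conn E V u v : rooted E V u v k -> connected_on E (V :\: [set u; v]) ->
    k < #|V| -> smaller_count_bound V ->
    (forall E' u' v', rooted E' V u' v' k -> rank E' V u' v' < rank E V u v -> count_bound E' V u' v') ->
  #|cliques E V s| < extremal s k #|V|.
Proof.
move=> G cH ltkV IH IHr.
have [//|domu] := dominating_step G cH ltkV IH (fun E' => IHr E' u v).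
have cH' : connected_on E (V :\: [set v; u]) by rewrite setUC.
have IHr' E' : rooted E' V v u k -> rank E' V v u < rank E V v u -> count_bound E' V v u.
  by rewrite (rank_sym E V v u); apply: IHr.
have [//|domv] := dominating_step (rooted_sym G) cH' ltkV IH IHr'.
rewrite setUC in domv; have [symE irrE uV vV uv lk bd] := G.
apply: kopylov_bound symE irrE uV vV (rooted_neq G) s_gt2 lesk ltkV cH _.
exact: pathfree_dominated.
Qed.

Theorem clique_bound E V u v : rooted E V u v k -> count_bound E V u v.
Proof.
have [n] := ubnP #|V|; elim: n E V u v => // n IHn E V u v ltn.
have IH : smaller_count_bound V.
  by move=> E' V' u' v' G' lt; apply: IHn => //; apply: leq_trans lt _.
have [m] := ubnP (rank E V u v); elim: m E u v => // m IHm E u v ltm G.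
have [le|lt] := leqP #|V| k; first exact: count_bound_small.
have [/connected_onP cH|] := boolP (connected_onb E (V :\: [set u; v])).
  apply: count_bound_lt; apply: (cliques_lt_conn G cH lt IH) => E' u' v' G' lt'.
  by apply: IHm => //; apply: leq_trans lt' _.
case/forallPn=> S; rewrite negb_imply => /andP[/andP[S0 sS] /exists_inPn noE].
apply: count_bound_disconnected G IH S0 sS _ => a b aS bS.
by have /exists_inPn := noE a aS; apply.
Qed.

Theorem clique_bound_conn E V u v : rooted E V u v k -> connected_on E (V :\: [set u; v]) ->
  k < #|V| -> #|cliques E V s| < extremal s k #|V|.
Proof.
move=> G cH lt; have [le eqN] := clique_bound G.
rewrite ltn_neqAle le andbT; apply/eqP => /eqN/(_ (ltnW lt))[Q [sQ uQ vQ cQ cardQ]].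
by have := no_clique G cH k_gt2 lt sQ uQ vQ cQ; rewrite cardQ eqxx.
Qed.

End Bound.

(** * Cycles, 2-connected graphs and the graph X *)

Lemma path_const (T : Type) (R : rel T) (P : pred T) a s :
  (forall b c, R b c -> P b = P c) -> path R a s -> all (fun t => P t == P a) s.
Proof.
move=> RP; elim: s a => //= b s IHs a /andP[Rab /IHs].
by rewrite (RP _ _ Rab) eqxx.
Qed.

Section Interface.

Variables (T : finType) (G : sgraph T).
Implicit Types (S V Z Y : {set T}) (x y z u v a b : T) (p q c : seq T).

Lemma cycle_path_next u v c : 2 < size c -> cycle G c -> uniq c -> u \in c -> next c u = v ->
  exists p, [/\ path G u p, last u p = v, uniq (u :: p) & (size p).+1 = size c].
Proof.
move=> szc cyc un uc nextv.
have [i p eqc] := rot_to uc.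
have sz : size c = (size p).+1 by rewrite -(size_rot i c) eqc.
have unp : uniq (u :: p) by rewrite -eqc rot_uniq.
have pp : path G u (rcons p u) by move: cyc; rewrite -(rot_cycle i) eqc.
have nE : next (u :: p) u = v by rewrite -eqc next_rot.
case: p sz unp pp nE {eqc} => [|w q] sz unp pp nE; first by rewrite sz in szc.
have wv : w = v by move: nE; rewrite /= eqxx.
subst w; move: pp; rewrite rcons_path => /andP[/= /andP[uv vq] lastu].
exists (rev (v :: q)); split.
- by rewrite path_rev; [rewrite adj_sym lastu|exact: adj_sym].
- by rewrite last_rev.
- by rewrite mem_rev rev_uniq.
- by rewrite size_rev sz.
Qed.

Lemma cycle_path u v c : cycle_through G u v c ->
  exists p, [/\ path G u p, last u p = v, uniq (u :: p) & (size p).+1 = size c].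
Proof.
case/and3P=> szc /andP[cyc un] /andP[uc /orP[] /eqP nextprev].
  exact: cycle_path_next nextprev.
rewrite -(size_rev c); apply: cycle_path_next; rewrite ?size_rev ?rev_uniq ?mem_rev //.
  rewrite rev_cycle; have /eq_cycle -> // : (fun x y => G y x) =2 G by move=> a b; rewrite adj_sym.
by rewrite next_rev.
Qed.

Lemma path_cycle u v p : G u v -> 1 < size p -> path G u p -> last u p = v ->
  uniq (u :: p) -> cycle_through G u v (u :: p).
Proof.
move=> uv szp pp lp un; apply/and3P; split=> //.
  by rewrite /ucycleb un andbT /= rcons_path pp lp adj_sym.
rewrite inE eqxx /=; apply/orP; right; apply/eqP; rewrite -lp.
case/andP: un => + _; have : forall w q, u \notin q -> prev_at u u w q = last w q.
  move=> w q; elim: q w => /= [|w' q IHq] w; first by rewrite eqxx.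
  by rewrite inE negb_or => /andP[/negPf-> /IHq].
exact.
Qed.

Lemma bounded_of_max u v k : 2 < k -> G u v -> max_cycle_length G u v <= k ->
  bounded G setT u v k.
Proof.
move=> k_gt2 uv maxk p pp lp un _; have [szp|szp] := leqP (size p) 1; first exact: leq_ltn_trans (ltnW k_gt2).
have szT : (size p).+1 < #|T|.+1 by rewrite ltnS; have := max_card (mem (u :: p)); rewrite (card_uniqP un).
apply: leq_trans maxk; apply: (bigmax_sup (Ordinal szT)) => //.
apply/existsP; exists (Tuple (eqxx (size (u :: p)))).
exact: path_cycle.
Qed.

Lemma long_path_of_max u v k : k < max_cycle_length G u v ->
  exists p, [/\ path G u p, last u p = v, uniq (u :: p) & k <= size p].
Proof.
rewrite ltnNge => /negP maxk.
have [/existsP[l /andP[ltkl /existsP[c /cycle_path[p [pp lp un sz]]]]]|none] :=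
    boolP [exists l : 'I_#|T|.+1, (k < l) && [exists c : l.-tuple T, cycle_through G u v c]].
  by exists p; split=> //; rewrite -ltnS sz size_tuple.
case: maxk; apply/bigmax_leqP => l hl; rewrite leqNgt; apply: contra none => ltkl.
by apply/existsP; exists l; rewrite ltkl.
Qed.

Lemma linked_of_two_connected u v : two_connected G -> G u v -> linked G setT u v.
Proof.
move=> [_ conG] uv x S /set0Pn[z zS] sS.
have neq_uv : u != v by apply: contraTneq uv => ->; rewrite adj_irrefl.
have SP t : t \in S -> [/\ t != u, t != v & t != x].
  by move/(subsetP sS); rewrite !inE !negb_or andbT -andbA => /and3P[].
have [t tuv tx] : exists2 t, t \in [set u; v] & t \notin [set x].
  have [eux|ux] := eqVneq u x; last by exists u; rewrite !inE ?eqxx.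
  by exists v; rewrite !inE ?eqxx ?orbT // -eux eq_sym.
have zx : z \notin [set x] by rewrite inE; case/SP: zS.
have [e|none] := boolP [exists a in S, exists b in ~: S, (b != x) && G a b].
  case/exists_inP: e => a aS /exists_inP[b bS /andP[bx ab]].
  by exists a, b; split=> //; rewrite setTD.
pose z' : {y : T | y \notin [set x]} := exist _ z zx.
pose t' : {y : T | y \notin [set x]} := exist _ t tx.
pose P (y : {y : T | y \notin [set x]}) := val y \in S.
have := conG [set x]; rewrite cards1 => /(_ isT z' t') /connectP[p pp lastp].
have /allP cst : all (fun w => P w == P z') p.
  apply: path_const pp => a b ab.
  have ax : val a != x by have := valP a; rewrite !inE.
  have bx : val b != x by have := valP b; rewrite !inE.
  apply/idP/idP => [aS|bS]; apply: contraR none => nS.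
    by apply/exists_inP; exists (val a) => //; apply/exists_inP; exists (val b); rewrite ?inE // bx.
  by apply/exists_inP; exists (val b) => //; apply/exists_inP; exists (val a); rewrite ?inE // ax adj_sym.
have tS : t \notin S.
  by apply/negP => /SP[tu tv _]; move: tuv; rewrite !inE (negPf tu) (negPf tv).
have : t' \in z' :: p by rewrite lastp mem_last.
rewrite inE => /predU1P[/(congr1 val)/= tz|/cst]; first by rewrite tz zS in tS.
by rewrite /P /= zS (negPf tS).
Qed.


End Interface.

Section CliquesOfX.

Variables b m q s : nat.
Hypothesis s_gt2 : 2 < s.

Let W := ('I_b * 'I_m + 'I_q)%type.
Let X := join (complete 2) (disjoint_union (copies (complete m) b) (complete q)).

Let blk (y : W) : option 'I_b := if y is inl p then Some p.1 else None.
Let P (o : option 'I_b) : {set 'I_2 + W} :=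
  [set x | if x is inr y then blk y == o else true].

Let PE o : P o = (inl @: [set: 'I_2]) :|: (inr @: [set y | blk y == o]).
Proof.
apply/setP => -[i|y]; rewrite !inE.
  by rewrite imset_f ?inE.
rewrite mem_imset; last by move=> ? ? [].
by rewrite inE; case: imsetP => // -[].
Qed.

Let blk_Some i : [set y | blk y == Some i] = (fun j => inl (i, j)) @: [set: 'I_m].
Proof.
apply/setP => -[[i' j]|j]; rewrite !inE /=.
  apply/eqP/imsetP => [[->]|[j' _ [-> _]]] //; by exists j; rewrite ?inE.
by apply/esym/negbTE/negP => /imsetP[].
Qed.

Let blk_None : [set y | blk y == None] = inr @: [set: 'I_q].
Proof.
apply/setP => -[[i' j]|j]; rewrite !inE /=; first by apply/esym/negbTE/negP => /imsetP[].
by rewrite imset_f ?inE.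
Qed.

Let card_P o : #|P o| = (if o is Some _ then m else q) + 2.
Proof.
rewrite PE cardsU disjoint_setI0; last first.
  by rewrite disjoints_subset; apply/subsetP => _ /imsetP[i _ ->]; rewrite inE; apply/imsetP => -[].
rewrite cards0 subn0 !card_imset ?cardsT ?card_ord; try by move=> ? ? [].
rewrite addnC; congr (_ + _); case: o => [i|].
  by rewrite blk_Some card_imset ?cardsT ?card_ord // => ? ? [].
by rewrite blk_None card_imset ?cardsT ?card_ord // => ? ? [].
Qed.

Let clique_P o : clique X (P o).
Proof.
apply/cliqueP => -[i|[[i j]|j]] [i'|[[i' j']|j']]; rewrite !inE //=.
- move=> /eqP<- /eqP[->]; rewrite /copies_rel /= eqxx /=.
  by apply: contraNneq => ->.
- by move=> /eqP<-.
- by move=> /eqP<-.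
Qed.

Lemma cliques_X : b * 'C(m + 2, s) + 'C(q + 2, s) <= num_cliques X s.
Proof.
pose A o := [set S : {set 'I_2 + W} | S \subset P o & #|S| == s].
have disA o o' : o != o' -> [disjoint A o & A o'].
  move=> oo'; rewrite disjoints_subset; apply/subsetP => S.
  rewrite !inE => /andP[sS /eqP cS]; rewrite cS eqxx andbT; apply/negP => sS'.
  have : S \subset inl @: [set: 'I_2].
    apply/subsetP => x xS; have := subsetP sS x xS; have := subsetP sS' x xS.
    rewrite !inE; case: x {xS} => [i _ _|y /eqP eo /eqP eo']; first by rewrite imset_f ?inE.
    by case/eqP: oo'; rewrite -eo.
  move/subset_leq_card; rewrite cS card_imset ?cardsT ?card_ord; last by move=> ? ? [].
  by rewrite leqNgt s_gt2.
have cA o : #|A o| = 'C((if o is Some _ then m else q) + 2, s) by rewrite cards_draws card_P.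
have -> : b * 'C(m + 2, s) + 'C(q + 2, s) = \sum_o #|A o|.
  rewrite (bigD1 None) //= cA addnC; congr (_ + _).
  rewrite (reindex_omap Some id) /=; last by case.
  rewrite (eq_bigr (fun=> 'C(m + 2, s))) => [|i _]; last exact: cA.
  by rewrite (eq_bigl (mem 'I_b)) ?sum_nat_const ?card_ord // => i; rewrite eqxx.
have <- : #|\bigcup_o A o| = \sum_o #|A o|.
  rewrite -sum1_card partition_disjoint_bigcup //.
  by apply: eq_bigr => o _; rewrite sum1_card.
apply/subset_leq_card/bigcupsP => o _; apply/subsetP => S.
by rewrite !inE => /andP[sS ->]; apply: cliqueS sS (clique_P o).
Qed.

End CliquesOfX.

(** * Extremal graphs *)

Section Structure.

Variables (T : finType) (s k : nat) (M : sgraph T) (u v : T).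
Hypotheses (s_gt2 : 2 < s) (lesk : s <= k) (G : rooted M setT u v k).
Hypothesis cliques_max : #|cliques M setT s| = extremal s k #|T|.
Hypothesis edge_max : forall x y, x != y -> ~~ M x y ->
  k < max_cycle_length (add_edge M x y) u v.
Implicit Types (S Y Z : {set T}) (x y z a b : T).

Let k_gt2 : 2 < k. Proof. exact: leq_trans lesk. Qed.

Variable H : {set T}.
Hypothesis HE : H = setT :\: [set u; v].

Let symM : symmetric M. Proof. exact: adj_sym. Qed.

Let neq_uv : u != v. Proof. exact: rooted_neq G. Qed.

Let inH x : (x \in H) = (x != u) && (x != v).
Proof. by rewrite HE !inE negb_or andbT. Qed.

Let card_H : #|T| = #|H| + 2.
Proof.
have := cardsID [set u; v] [set: T]; rewrite -HE setTI cards2 neq_uv cardsT addnC.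
by move=> <-.
Qed.

Definition separated Z := (Z \subset H) && [forall a in Z, forall b in H :\: Z, ~~ M a b].

Let separatedP Z : reflect (Z \subset H /\
  forall a b, a \in Z -> b \in H -> b \notin Z -> ~~ M a b) (separated Z).
Proof.
apply: (iffP andP) => -[sZ noM]; split=> //.
  move=> a b aZ bH bZ; have /forall_inP := forall_inP noM a aZ; apply.
  by rewrite in_setD bZ.
apply/forall_inP => a aZ; apply/forall_inP => b; rewrite in_setD => /andP[bZ bH].
exact: noM.
Qed.

Let separatedC Z : separated Z -> separated (H :\: Z).
Proof.
move=> /separatedP[sZ noM]; apply/separatedP; split; first exact: subsetDl.
move=> a b; rewrite !in_setD negb_and negbK => /andP[aZ aH] bH.
by rewrite bH orbF => bZ; rewrite symM; apply: noM.
Qed.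

Let separatedU Y Z : separated Y -> separated Z -> separated (Y :|: Z).
Proof.
move=> /separatedP[sY nY] /separatedP[sZ nZ]; apply/separatedP; split.
  by rewrite subUset sY.
move=> a b; rewrite !in_setU negb_or => /orP[aY|aZ] bH /andP[bY bZ]; first exact: nY.
exact: nZ.
Qed.

Let separated_rooted Z : separated Z -> rooted M (Z :|: [set u; v]) u v k.
Proof.
move=> /separatedP[sZ nZ]; apply: (rooted_closed G); first by rewrite -HE.
by move=> a b aZ _ bZ buv; apply: nZ => //; rewrite HE inE buv inE.
Qed.

Let separated_card Z : separated Z -> #|Z :|: [set u; v]| = #|Z| + 2.
Proof. by move=> /separatedP[sZ _]; apply: (card_rooted_set G); rewrite -HE. Qed.

Let separated_split Y Z : separated Y -> Z \subset H ->
  #|cliques M ((Y :|: Z) :|: [set u; v]) s|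
    <= #|cliques M (Y :|: [set u; v]) s| + #|cliques M (Z :|: [set u; v]) s|.
Proof.
move=> /separatedP[sY nY] sZ; apply: cliques_split.
  apply/subsetP => t; rewrite !in_setU.
  by case: (t \in Y); case: (t \in Z); rewrite ?orbT //= => ->.
move=> x y; rewrite ![_ \in _ :|: [set u; v]]in_setU ![_ \in _ :|: Z]in_setU.
move=> xV yV; rewrite !negb_or => /andP[xY xuv] /andP[yZ yuv].
rewrite symM; apply: nY => //; last first.
  by rewrite HE in_setD xuv inE.
by move: yV; rewrite (negPf yZ) (negPf yuv) !orbF.
Qed.

Let separated_full Z : separated Z -> extremal s k (#|Z| + 2) <= #|cliques M (Z :|: [set u; v]) s|.
Proof.
move=> sepZ; have /separatedP[sZ _] := sepZ.
rewrite leqNgt; apply/negP => lt1.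
have [le2 _] := clique_bound s_gt2 lesk (separated_rooted (separatedC sepZ)).
rewrite (separated_card (separatedC sepZ)) in le2.
have := separated_split sepZ (subsetDl H Z).
have -> : Z :|: H :\: Z :|: [set u; v] = setT.
  by apply/setP => t; rewrite HE !inE; case: (t \in Z); case: (t == u); case: (t == v).
rewrite cliques_max card_H; apply/negP; rewrite -ltnNge.
have := @extremal_superadd s k s_gt2 lesk (#|Z| + 2) (#|H :\: Z| + 2).
rewrite !leq_addl => /(_ isT isT); have := subset_leq_card sZ.
have eH : #|H :\: Z| = #|H| - #|Z| by rewrite cardsDS.
rewrite eH in le2 *; move=> leZ; have -> : #|Z| + 2 + (#|H| - #|Z| + 2) - 2 = #|H| + 2 by move: leZ; clear; lia.
by move: lt1 le2; clear; lia.
Qed.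

Let separated_adj Z x y : separated Z -> #|Z| + 2 <= k -> x \in Z ->
  y \in Z :|: [set u; v] -> x != y -> M x y.
Proof.
move=> /separatedP[sZ nZ] leZ xZ yZ xy; apply: contraT => nxy.
have [p [pp lp un szp]] := long_path_of_max (edge_max xy nxy).
case/lastP: p pp lp un szp => [|p w]; first by move=> _ _ _ /=; move: k_gt2; clear; lia.
rewrite last_rcons size_rcons => pp wv; subst w; rewrite -rcons_cons rcons_uniq => /andP[vp unp] szp.
have pH : {subset p <= H}.
  move=> t tp; rewrite inH; apply/andP; split.
    by apply: contraTneq tp => ->; case/andP: unp.
  by apply: contraNneq vp => <-; rewrite inE tp orbT.
have xH := subsetP sZ x xZ.
case: p pp unp vp szp pH => [|a p] pp unp vp szp pH; first by move: szp k_gt2 => /=; clear; lia.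
have cst : all (fun t => (t \in Z) == (a \in Z)) p.
  have pap : path (add_edge M x y) a p by move: pp; rewrite rcons_path /= => /andP[/andP[]].
  have : path (fun b c => (b \in Z) == (c \in Z)) a p.
    apply: (@sub_in_path _ (mem H) (add_edge M x y)) pap; last first.
      by apply/allP => t; apply: pH.
    move=> b c bH cH /orP[bc|/andP[_]].
      apply/eqP; apply/idP/idP => [bZ|cZ]; apply: contraTT bc => nZ'; first exact: nZ.
      by rewrite symM; apply: nZ.
    have yZH : y \in H -> y \in Z.
      by move: yZ; rewrite inE inH => /orP[//|]; rewrite !inE => /orP[] /eqP->; rewrite eqxx ?andbF.
    by case/orP=> /andP[/eqP eb /eqP ec]; move: bH cH; rewrite eb ec /= => bH cH; rewrite xZ yZH.
  by move/(path_const (P := mem Z)); apply=> b c /eqP.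
have [aZ|aZ] := boolP (a \in Z).
  have : size (a :: p) <= #|Z|.
    have up : uniq (a :: p) by case/andP: unp.
    rewrite -(card_uniqP up); apply/subset_leq_card/subsetP => t; rewrite inE => /predU1P[->//|tp].
    by have /allP/(_ t tp) := cst; rewrite aZ => /eqP.
  by move: szp leZ => /=; clear; lia.
have xout : x \notin u :: rcons (a :: p) v.
  rewrite inE mem_rcons inE negb_or; move: xH; rewrite inH => /andP[-> xv].
  rewrite negb_or xv /=; apply: contraL xZ; rewrite inE => /predU1P[->//|xp].
  by have /allP/(_ x xp) := cst; rewrite (negPf aZ) => /eqP->.
have ppM : path M u (rcons (a :: p) v).
  apply: (@sub_in_path _ (mem (u :: rcons (a :: p) v)) (add_edge M x y)) pp; last exact/allP.
  move=> b c bin cin /orP[//|/andP[_] /orP[] /andP[/eqP eb /eqP ec]].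
    by move: xout; rewrite -eb; move: bin => /= ->.
  by move: xout; rewrite -ec; move: cin => /= ->.
have : size (rcons (a :: p) v) < k.
  apply: (rbounded G) => //; first by rewrite last_rcons.
    by rewrite -rcons_cons rcons_uniq vp.
  by move=> t _; rewrite inE.
by rewrite size_rcons ltnNge szp.
Qed.

Let e := [rel x y | [&& M x y, x \in H & y \in H]].

Let symC : connect_sym e.
Proof. by apply: sym_connect_sym => x y /=; rewrite symM [(x \in H) && _]andbC. Qed.

Let equivC : {in H & &, equivalence_rel (connect e)}.
Proof.
move=> x y z _ _ _; split; first exact: connect0.
by move=> xy; apply: same_connect.
Qed.

Let P := equivalence_partition (connect e) H.

Let partP : partition P H. Proof. exact: equivalence_partitionP. Qed.

Let trivP : trivIset P. Proof. by case/and3P: partP. Qed.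

Let coverP : cover P = H. Proof. by case/and3P: partP => /eqP. Qed.

Let blockP x : x \in H -> pblock P x \in P /\ x \in pblock P x.
Proof. by rewrite -coverP => xP; rewrite pblock_mem // mem_pblock. Qed.

Let block_sub Y : Y \in P -> Y \subset H.
Proof. by move=> YP; rewrite -coverP; apply: (bigcup_max Y). Qed.

Let block_connect Y x y : Y \in P -> x \in Y -> y \in H -> (y \in Y) = connect e x y.
Proof.
move=> YP xY yH; have xH := subsetP (block_sub YP) x xY.
by rewrite -(def_pblock trivP YP xY) pblock_equivalence_partition.
Qed.

Let block_separated Y : Y \in P -> separated Y.
Proof.
move=> YP; apply/separatedP; split; first exact: block_sub.
move=> a b aY bH; apply: contra => ab; rewrite (block_connect YP aY bH).
by apply: connect1; rewrite /= ab bH (subsetP (block_sub YP)).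
Qed.

Let block_conn Y : Y \in P -> connected_on M Y.
Proof.
move=> YP S /set0Pn[z zS] /properP[/subsetP sSY [y yY yS]].
have [|none] := boolP [exists a in S, exists b in Y :\: S, M a b].
  by case/exists_inP=> a aS /exists_inP[b bS ab]; exists a, b.
have yH := subsetP (block_sub YP) y yY.
have : connect e z y by rewrite -(block_connect YP (sSY z zS) yH).
have /separatedP[_ nY] := block_separated YP.
have stay a b : e a b -> a \in S -> b \in S.
  case/and3P=> ab aH bH aS; apply: contraR none => bS.
  apply/exists_inP; exists a => //; apply/exists_inP; exists b => //.
  by rewrite inE bS; apply: contraTT ab; apply: nY => //; apply: sSY.
case/connectP=> p pp lp; have yzp : y \in z :: p by rewrite lp mem_last.
have : all (fun t => (t \in S) == (z \in S)) p.
  apply: (path_const (P := mem S)) pp => a b ab; apply/idP/idP; first exact: stay.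
  by apply: stay; move: ab; rewrite /= symM => /and3P[-> -> ->].
move: yzp; rewrite inE => /predU1P[yz|yp /allP/(_ y yp)]; first by rewrite yz zS in yS.
by rewrite zS (negPf yS).
Qed.

Let block_le Y : Y \in P -> #|Y| + 2 <= k.
Proof.
move=> YP; have sepY := block_separated YP.
rewrite leqNgt; apply/negP => gtk; have := separated_full sepY; apply/negP; rewrite -ltnNge.
rewrite -(separated_card sepY).
apply: (clique_bound_conn s_gt2 lesk (separated_rooted sepY)); last by rewrite separated_card.
rewrite (_ : _ :\: _ = Y); first exact: block_conn.
have /subsetP sY := block_sub YP.
apply/setP => t; rewrite in_setD [t \in Y :|: _]in_setU; case tY: (t \in Y).
  by have := sY t tY; rewrite HE in_setD => /andP[->].
by rewrite andNb.
Qed.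

Let block_disjoint Y Z : Y \in P -> Z \in P -> Y != Z -> [disjoint Y & Z].
Proof. by move=> YP ZP; have /trivIsetP := trivP; apply. Qed.

Let block_full Y Z : Y \in P -> Z \in P -> Y != Z -> #|Y| != k - 2 -> #|Z| = k - 2.
Proof.
move=> YP ZP YZ Ynf; apply/eqP; apply: contraT => Znf.
have sepY := block_separated YP; have sepZ := block_separated ZP.
have sepYZ := separatedU sepY sepZ; have disj := block_disjoint YP ZP YZ.
have cYZ : #|Y :|: Z| = #|Y| + #|Z| by rewrite cardsU (disjoint_setI0 disj) cards0 subn0.
have leY := block_le YP; have leZ := block_le ZP.
have ltk : k < #|Y| + #|Z| + 2.
  rewrite ltnNge; apply/negP => le.
  have [/set0Pn[y yY] /set0Pn[z zZ]] : Y != set0 /\ Z != set0.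
    by case/and3P: partP => _ _ nP; split; [apply: contraNneq nP => <-|apply: contraNneq nP => <-].
  have zY : z \notin Y by rewrite (disjointFl disj zZ).
  have : M y z.
    apply: (separated_adj sepYZ); rewrite ?cYZ // ?in_setU ?yY ?zZ ?orbT //.
    by apply: contraNneq zY => <-.
  have /separatedP[_ nY] := sepY; apply/negP; apply: nY => //.
  exact: (subsetP (block_sub ZP)).
have := separated_full sepYZ; rewrite leqNgt => /negP[]; rewrite cYZ.
apply: leq_ltn_trans (separated_split sepY (block_sub ZP)) _.
have [le1 _] := clique_bound s_gt2 lesk (separated_rooted sepY).
have [le2 _] := clique_bound s_gt2 lesk (separated_rooted sepZ).
rewrite !separated_card // in le1 le2.
have := @extremal_superadd_strict s k s_gt2 lesk (#|Y| + 2) (#|Z| + 2).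
have -> : #|Y| + 2 + (#|Z| + 2) - 2 = #|Y| + #|Z| + 2 by clear; lia.
move: le1 le2 ltk leY leZ Ynf Znf k_gt2; clear; lia.
Qed.

Let F := [set Y in P | #|Y| == k - 2].

Let R := H :\: cover F.

Let card_cover : #|cover F| = #|F| * (k - 2).
Proof.
have sF : F \subset P by apply/subsetP => Y; rewrite inE => /andP[].
have /eqP <- := trivIsetS sF trivP.
rewrite (eq_bigr (fun=> k - 2)) ?sum_nat_const // => Y.
by rewrite inE => /andP[_ /eqP].
Qed.

Let in_cover x : x \in H -> (x \in cover F) = (#|pblock P x| == k - 2).
Proof.
move=> xH; have [bP xb] := blockP xH; apply/bigcupP/idP => [[Y]|bk].
  by rewrite inE => /andP[YP cY] xY; rewrite (def_pblock trivP YP xY).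
by exists (pblock P x); rewrite ?inE ?bP.
Qed.

Let R_block x y : x \in R -> y \in R -> pblock P x = pblock P y.
Proof.
rewrite !in_setD => /andP[xF xH] /andP[yF yH]; apply/eqP; apply: contraT => neq.
have [xP _] := blockP xH; have [yP _] := blockP yH.
rewrite in_cover // in xF; rewrite in_cover // in yF.
by rewrite (block_full xP yP neq xF) eqxx in yF.
Qed.

Let card_R : #|R| < k - 2.
Proof.
have [->|/set0Pn[x xR]] := eqVneq R set0; first by rewrite cards0 subn_gt0.
have xH : x \in H by move: xR; rewrite in_setD => /andP[].
have [bP xb] := blockP xH.
have : #|pblock P x| < k - 2.
  have := block_le bP; have : #|pblock P x| != k - 2.
    by rewrite -in_cover //; move: xR; rewrite in_setD => /andP[].
  by clear; lia.
apply: leq_ltn_trans; apply/subset_leq_card/subsetP => y yR.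
rewrite (R_block xR yR); have [] // := @blockP y.
by move: yR; rewrite in_setD => /andP[].
Qed.

Let sub_coverH : cover F \subset H.
Proof. by apply/bigcupsP => Y; rewrite inE => /andP[/block_sub]. Qed.

Let size_eq : #|T| - 2 = #|F| * (k - 2) + #|R|.
Proof.
rewrite card_H addnK -card_cover -(cardsID (cover F) H); congr (_ + _).
by rewrite (setIidPr sub_coverH).
Qed.

Let F_beta : #|F| = beta #|T| k.
Proof. by rewrite /beta size_eq divnMDl ?subn_gt0 // divn_small ?card_R // addn0. Qed.

Let R_rem : #|R| = remainder #|T| k.
Proof. by rewrite /remainder -F_beta size_eq addKn. Qed.

Let adj_H x y : x \in H -> y \in H -> x != y -> M x y = (pblock P x == pblock P y).
Proof.
move=> xH yH xy; have [xP xb] := blockP xH; have [yP yb] := blockP yH.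
apply/idP/eqP => [Mxy|eqb].
  have /separatedP[_ nx] := block_separated xP.
  have ybx : y \in pblock P x by apply: contraTT Mxy; apply: nx.
  by rewrite (def_pblock trivP xP ybx).
apply: (separated_adj (block_separated xP)) => //; first exact: block_le.
by rewrite eqb in_setU yb.
Qed.

Let adj_uv x : x \in H -> M x u && M x v.
Proof.
move=> xH; have [xP xb] := blockP xH; have := xH; rewrite inH => /andP[xu xv].
by rewrite !(separated_adj (block_separated xP)) ?block_le // !inE eqxx ?orbT.
Qed.

Let n := #|T|.
Let W := ('I_(beta n k) * 'I_(k - 2) + 'I_(remainder n k))%type.

Let Bl (i : 'I_(beta n k)) := nth set0 (enum F) i.

Let inner (y : W) : T := match y with
  | inl p => nth u (enum (Bl p.1)) p.2
  | inr j => nth u (enum R) j end.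

Let place (x : 'I_2 + W) : T := match x with
  | inl i => if i == ord0 then u else v
  | inr y => inner y end.

Let BlF i : Bl i \in F.
Proof. by rewrite -mem_enum mem_nth // -cardE F_beta. Qed.

Let BlP i : Bl i \in P. Proof. by have := BlF i; rewrite inE => /andP[]. Qed.

Let card_Bl i : #|Bl i| = k - 2. Proof. by have := BlF i; rewrite inE => /andP[_ /eqP]. Qed.

Let Bl_inj i i' : (Bl i == Bl i') = (i == i').
Proof. by rewrite nth_uniq ?enum_uniq // -cardE F_beta. Qed.

Let inner_Bl i j : inner (inl (i, j)) \in Bl i.
Proof. by rewrite -mem_enum mem_nth // -cardE card_Bl. Qed.

Let inner_R j : inner (inr j) \in R.
Proof. by rewrite -mem_enum mem_nth // -cardE R_rem. Qed.

Let inner_H w : inner w \in H.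
Proof.
case: w => [[i j]|j]; first exact: (subsetP (block_sub (BlP i)) _ (inner_Bl i j)).
by have := inner_R j; rewrite in_setD => /andP[].
Qed.

Let pblock_Bl i j : pblock P (inner (inl (i, j))) = Bl i.
Proof. exact: def_pblock (BlP i) (inner_Bl i j). Qed.

Let pblock_R i j : pblock P (inner (inr j)) != Bl i.
Proof.
have := inner_R j; rewrite in_setD in_cover ?inner_H // => /andP[nF _].
by apply: contraNneq nF => ->; rewrite card_Bl.
Qed.

Let inner_inj : injective inner.
Proof.
move=> [[i j]|j] [[i' j']|j'] eqi.
- have /eqP := congr1 (pblock P) eqi; rewrite !pblock_Bl Bl_inj => /eqP ii'.
  subst i'; move/eqP: eqi; rewrite /= nth_uniq ?enum_uniq -?cardE ?card_Bl //.
  by move/eqP/val_inj->.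
- by have := pblock_R i j'; rewrite -eqi pblock_Bl eqxx.
- by have := pblock_R i' j; rewrite eqi pblock_Bl eqxx.
move/eqP: eqi; rewrite /= nth_uniq ?enum_uniq -?cardE ?R_rem //.
by move/eqP/val_inj->.
Qed.

Let two_points (i : 'I_2) : i = ord0 \/ i = ord_max.
Proof. by case: i => [[|[]]] // ?; [left|right]; apply: val_inj. Qed.

Let place_inj : injective place.
Proof.
have outH i w : place (inl i) = inner w -> False.
  by move=> eqi; have := inner_H w; rewrite -eqi inH /=; case: ifP; rewrite eqxx ?andbF.
move=> [i|y] [i'|y'] //= eqp.
- case: (two_points i) (two_points i') eqp => -> [] -> //= /eqP.
    by rewrite (negPf neq_uv).
  by rewrite eq_sym (negPf neq_uv).
- by case: (outH i y').
- by case: (outH i' y).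
by rewrite (inner_inj eqp).
Qed.

Let inner_adj w w' : M (inner w) (inner w') =
  disjoint_union (copies (complete (k - 2)) (beta n k)) (complete (remainder n k)) w w'.
Proof.
have [->|yy'] := eqVneq w w'; first by rewrite !adj_irrefl.
rewrite adj_H ?inner_H //; last by apply: contraNneq yy' => /inner_inj->.
case: w w' yy' => [[i j]|j] [[i' j']|j'] yy' /=.
- rewrite !pblock_Bl Bl_inj /copies_rel /=; have [ii|//] := eqVneq i i'.
  by rewrite ii in yy' *; apply/esym; apply: contraNneq yy' => ->.
- by rewrite pblock_Bl eq_sym; apply/negbTE/pblock_R.
- by rewrite pblock_Bl; apply/negbTE/pblock_R.
rewrite (R_block (inner_R j) (inner_R j')) eqxx; apply/esym.
by apply: contraNneq yy' => ->.
Qed.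

Let place_adj w w' : M (place w) (place w') = X_graph n k w w'.
Proof.
case: w w' => [i|y] [i'|y'] /=.
- case: (two_points i) => ->; case: (two_points i') => -> //=; rewrite ?adj_irrefl //.
    exact: ruv G.
  by rewrite symM (ruv G).
- by rewrite symM; have /andP[] := adj_uv (inner_H y'); case: ifP.
- by have /andP[] := adj_uv (inner_H y); case: ifP.
exact: inner_adj.
Qed.

Lemma iso_X : graph_iso M (X_graph #|T| k).
Proof.
have [|h hK Kh] := inj_card_bij place_inj.
  rewrite !card_sum card_prod !card_ord /remainder /beta.
  have := leq_divM (#|T| - 2) (k - 2); rewrite /n card_H; clear; lia.
exists h; first by exists place.
by move=> x y; rewrite -place_adj !Kh.
Qed.

End Structure.

Theorem theorem6 (n k s : nat) (T : finType) (G : sgraph T) (u v : T)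
    (hn : 3 <= n) (hs : 3 <= s) (hsk : s <= k) (hT : #|T| = n)
    (hG : two_connected G) (huv : G u v) (hc : max_cycle_length G u v <= k)
    (hN : num_cliques G s = g s n k) :
  forall M : sgraph T, edge_maximal G u v k M -> graph_iso M (X_graph n k).
Proof.
move=> M [sub maxM emaxM]; subst n.
have k_gt2 : 2 < k by apply: leq_trans hsk.
have lkG := linked_of_two_connected hG huv.
have GM : rooted M setT u v k.
  split; rewrite ?inE //; [exact: adj_sym|exact: adj_irrefl|exact: sub| |].
    move=> x S S0 sS; have [a [b [aS bS bx ab]]] := lkG x S S0 sS.
    by exists a, b; split=> //; apply: sub.
  by apply: bounded_of_max => //; apply: sub.
have cE (K : sgraph T) : num_cliques K s = #|cliques K setT s|.
  by apply: eq_card => S; rewrite !inE subsetT.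
apply: (iso_X hs hsk GM _ emaxM (erefl _)); apply/eqP; rewrite eqn_leq.
have [le _] := clique_bound hs hsk GM; rewrite cardsT in le; rewrite le /=.
have leGM : #|cliques G setT s| <= #|cliques M setT s|.
  by apply: cliques_mono => x y _ _; apply: sub.
apply: leq_trans leGM; rewrite -cE hN /g.
apply: leq_trans (cliques_X (beta #|T| k) (k - 2) (remainder #|T| k) hs).
have -> : remainder #|T| k = (#|T| - 2) %% (k - 2).
  by rewrite /remainder /beta {1}(divn_eq (#|T| - 2) (k - 2)) addKn.
by rewrite subnK // ltnW.
Qed.
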